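(* Let $\Omega\subset\mathbb{Q}_p$ be a $p$-homogeneous compact open set with $\mathfrak{m}(\Omega)>0$, and let $I_\Omega$ be its set of admissible $p$-orders. (a) The set $\Lambda_0=\sum_{i\in I_\Omega}(\mathbb{Z}/p\mathbb{Z})\cdot p^{-i-1}$ is a spectrum of $\Omega$. Moreover, a set $\Lambda\subset\mathbb{Q}_p$ is a spectrum of $\Omega$ if and only if $\Lambda=f(\Lambda_0)$ for some isometric bijection $f:\mathbb{Q}_p\to\mathbb{Q}_p$. (b) The set $T_0=\sum_{i\in\mathbb{Z}\setminus I_\Omega}(\mathbb{Z}/p\mathbb{Z})\cdot p^{i}$ is a tiling complement of $\Omega$. Moreover, a set $T\subset\mathbb{Q}_p$ is a tiling complement of $\Omega$ if and only if $T=f(T_0)$ for some isometric bijection $f:\mathbb{Q}_p\to\mathbb{Q}_p$.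
   Context: $p\ge2$ is a prime. $\mathbb{Q}_p$ and $\mathbb{Z}_p$ are the $p$-adic numbers and $p$-adic integers, with valuation $v_p$ and $|x|_p=p^{-v_p(x)}$. $\mathfrak{m}$ is the Haar measure with $\mathfrak{m}(\mathbb{Z}_p)=1$. Balls are $B(a,p^n)=a+p^{-n}\mathbb{Z}_p$. Characters: $\chi(x)=e^{2\pi i\{x\}}$, where $\{x\}=\sum_{n=v_p(x)}^{-1}a_np^n$ is the fractional part of $x=\sum_{n\ge v_p(x)}a_np^n$ with digits $a_n\in\{0,\dots,p-1\}$. Also $\chi_y(x)=\chi(yx)$. Spectrum: $\Lambda$ is a spectrum of $\Omega$ if $\{\chi_\lambda|_\Omega\}_{\lambda\in\Lambda}$ is an orthonormal basis of $L^2(\mathfrak{m}|_\Omega/\mathfrak{m}(\Omega))$. Tiling complement: $T$ is a tiling complement of $\Omega$ if $\sum_{t\in T}1_\Omega(x-t)=1$ for a.e. $x\in\mathbb{Q}_p$. Admissible $p$-orders: for $E\subset\mathbb{Q}_p$, $I_E=\{v_p(x-y): x,y\in E,\ x\neq y\}$. Sum notation: $(\mathbb{Z}/p\mathbb{Z})\cdot p^i=\{ap^i: a\in\{0,1,\dots,p-1\}\}$. For sets $A_i\ni 0$, $\sum_{i\in I}A_i$ is the set of all finite sums $\sum_{i\in J}a_i$ with $J\subset I$ finite and $a_i\in A_i$. $p$-homogeneity of a compact open set: let $\mathcal{N}_n(\Omega)$ be the set of balls of radius $p^{-n}$ meeting $\Omega$. $\Omega$ is $p$-homogeneous if for each $n\in\mathbb{Z}$,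 either every ball of $\mathcal{N}_n(\Omega)$ contains exactly one ball of $\mathcal{N}_{n+1}(\Omega)$, or every ball of $\mathcal{N}_n(\Omega)$ contains exactly $p$ balls of $\mathcal{N}_{n+1}(\Omega)$. *)

(* Defs.v *)
From HB Require Import structures.
From Stdlib Require Import ClassicalEpsilon ProofIrrelevance FunctionalExtensionality.
From mathcomp Require Import all_boot all_order all_algebra.
From mathcomp Require Import all_classical all_reals all_analysis.
Set Implicit Arguments. Unset Strict Implicit. Unset Printing Implicit Defensive.
Import Order.TTheory GRing.Theory Num.Theory.
Local Open Scope classical_set_scope.
Local Open Scope ring_scope.
Local Open Scope card_scope.

Section Qp.
Variable p : nat.
Hypothesis p_gt0 : (0 < p)%N.

(* digit expansions x = sum_{n >= v} a_n p^n, digits a_n in {0..p-1} *)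
Definition qp_valid (d : int -> nat) :=
  (forall n, (d n < p)%N) /\ exists N : int, forall n, n < N -> d n = 0%N.

(* the parameter h only records that p > 0 (p prime in the application) *)
Record QP_ (h : (0 < p)%N) := MkQP { digit : int -> nat; digitP : qp_valid digit }.
Local Notation QP := (QP_ p_gt0).

HB.instance Definition _ := gen_eqMixin QP.
HB.instance Definition _ := gen_choiceMixin QP.

Lemma qp_zero_valid : qp_valid (fun _ => 0%N).
Proof. by split=> //; exists 0%R. Qed.
Definition qp_zero : QP := @MkQP p_gt0 _ qp_zero_valid.
HB.instance Definition _ := isPointed.Build QP qp_zero.

Definition lb (x : QP) : int :=
  epsilon (inhabits 0) (fun N => forall n, n < N -> digit x n = 0%N).

Fixpoint add_carry (x y : int -> nat) (N : int) (k : nat) : nat :=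
  if k is k'.+1 then
    let j : int := N + k'%:Z in
    (x j + y j + add_carry x y N k')%N %/ p
  else 0%N.

Definition add_raw (x y : int -> nat) (N : int) (n : int) : nat :=
  if (n < N)%R then 0%N else let k := absz (n - N)%R in ((x n + y n + add_carry x y N k) %% p)%N.

Lemma add_raw_valid x y N : qp_valid (add_raw x y N).
Proof.
split=> [n|]; first by rewrite /add_raw; case: ifP => // _; rewrite ltn_pmod.
by exists N => n hn; rewrite /add_raw hn.
Qed.

Definition qp_add (x y : QP) : QP :=
  @MkQP p_gt0 _ (add_raw_valid (digit x) (digit y) (Num.min (lb x) (lb y))).

Definition conv (x y : int -> nat) (Nx Ny : int) (k : nat) : nat :=
  \sum_(i < k.+1) (x (Nx + i%:Z)%R * y (Ny + (k - i)%N%:Z)%R)%N.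

Fixpoint mul_carry (x y : int -> nat) (Nx Ny : int) (k : nat) : nat :=
  if k is k'.+1 then (conv x y Nx Ny k' + mul_carry x y Nx Ny k')%N %/ p
  else 0%N.

Definition mul_raw (x y : int -> nat) (Nx Ny : int) (n : int) : nat :=
  if (n < Nx + Ny)%R then 0%N
  else let k := absz (n - (Nx + Ny))%R in
    ((conv x y Nx Ny k + mul_carry x y Nx Ny k) %% p)%N.

Lemma mul_raw_valid x y Nx Ny : qp_valid (mul_raw x y Nx Ny).
Proof.
split=> [n|]; first by rewrite /mul_raw; case: ifP => // _; rewrite ltn_pmod.
by exists (Nx + Ny)%R => n hn; rewrite /mul_raw hn.
Qed.

Definition qp_mul (x y : QP) : QP :=
  @MkQP p_gt0 _ (mul_raw_valid (digit x) (digit y) (lb x) (lb y)).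

Definition qp_sub (x y : QP) : QP :=
  epsilon (inhabits qp_zero) (fun z => qp_add z y = x).

Lemma mono_valid (a : 'I_p) (k : int) :
  qp_valid (fun n => if n == k then nat_of_ord a else 0%N).
Proof.
split=> [n|]; first by case: ifP.
by exists k => n hn; rewrite lt_eqF.
Qed.
Definition qp_mono (a : 'I_p) (k : int) : QP := @MkQP p_gt0 _ (mono_valid a k).

(* p-adic valuation (for x <> 0) and absolute value |x|_p (a rational) *)
Definition vp (x : QP) : int :=
  epsilon (inhabits 0) (fun v => digit x v <> 0%N /\ forall n, n < v -> digit x n = 0%N).

Definition absp (x : QP) : rat :=
  if x == qp_zero then 0 else (p%:R : rat) ^ (- vp x).

(* fractional part {x} = sum_{n = v_p(x)}^{-1} a_n p^n (a rational) *)
Definition frac (x : QP) : rat :=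
  \sum_(k < `|Num.min (lb x) 0|%N)
     ((digit x (lb x + k%:Z))%:R * (p%:R : rat) ^ (lb x + k%:Z)).

Definition qp_ball (a : QP) (n : int) : set QP :=
  [set x | absp (qp_sub x a) <= (p%:R : rat) ^ (- n)].

Definition qp_balls : set (set QP) := [set B | exists a n, B = qp_ball a n].

Definition QPm := g_sigma_algebraType qp_balls.

(* Haar measure normalized by m(Z_p) = 1 : m(a + p^n Z_p) = p^(-n) *)
Definition haar_measure (R : realType) (m : set QPm -> \bar R) :=
  forall (a : QP) (n : int), m (qp_ball a n) = ((p%:R : R) ^ (- n))%:E.

Definition qp_open (U : set QP) :=
  forall x, U x -> exists n : int, qp_ball x n `<=` U.

Definition qp_compact (K : set QP) :=
  forall (I : Type) (U : I -> set QP), (forall i, qp_open (U i)) ->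
    K `<=` \bigcup_(i in setT) U i ->
    exists F : set I, finite_set F /\ K `<=` \bigcup_(i in F) U i.

Definition Nballs (Om : set QP) (n : int) : set (set QP) :=
  [set B | exists a, B = qp_ball a n /\ B `&` Om !=set0].

Definition p_homogeneous (Om : set QP) :=
  forall n : int,
    (forall B, Nballs Om n B ->
       [set B' | Nballs Om (n + 1) B' /\ B' `<=` B] #= [set: 'I_1])
 \/ (forall B, Nballs Om n B ->
       [set B' | Nballs Om (n + 1) B' /\ B' `<=` B] #= [set: 'I_p]).

Definition adm_orders (E : set QP) : set int :=
  [set v | exists x y, E x /\ E y /\ x <> y /\ vp (qp_sub x y) = v].

Definition digit_sumset (I : set int) (e : int -> int) : set QP :=
  [set x | exists (s : seq int) (a : int -> 'I_p),
     uniq s /\ (forall i, i \in s -> I i) /\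
     x = foldr (fun i acc => qp_add (qp_mono (a i) (e i)) acc) qp_zero s].

Definition Lambda0 (Om : set QP) := digit_sumset (adm_orders Om) (fun i => - i - 1).
Definition T0 (Om : set QP) := digit_sumset (~` adm_orders Om) (fun i => i).

(* chi_l(x) = exp(2 pi i {l x}) = cos(theta l x) + i sin(theta l x) *)
Definition theta (R : realType) (l x : QP) : R := 2 * pi * ratr (frac (qp_mul l x)).

(* Lambda is a spectrum: {chi_l|_Om} is an orthonormal basis of
   L^2(m|_Om / m(Om)); complex values written via real/imag parts *)
Definition spectrum (R : realType) (m : {measure set QPm -> \bar R})
    (Om : set QPm) (Lam : set QPm) :=
  (forall l l', Lam l -> Lam l' ->
     (\int[m]_(x in Om) ((fine (m Om))^-1 * cos (theta R l x - theta R l' x))%:E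
        = (if l == l' then 1 else 0)%:E)%E /\
     (\int[m]_(x in Om) ((fine (m Om))^-1 * sin (theta R l x - theta R l' x))%:E
        = 0)%E)
  /\
  (forall u v : QPm -> R,
     measurable_fun Om u -> measurable_fun Om v ->
     m.-integrable Om (fun x => (u x ^+ 2)%:E) ->
     m.-integrable Om (fun x => (v x ^+ 2)%:E) ->
     (forall l, Lam l ->
        (\int[m]_(x in Om) (u x * cos (theta R l x) + v x * sin (theta R l x))%:E = 0)%E
        /\ (\int[m]_(x in Om) (v x * cos (theta R l x) - u x * sin (theta R l x))%:E = 0)%E) ->
     {ae m, forall x, Om x -> u x = 0 /\ v x = 0}).

Definition tiling_complement (R : realType) (m : {measure set QPm -> \bar R})
    (Om : set QPm) (T : set QPm) :=
  {ae m, forall x : QPm, (\esum_(t in T) (\1_Om (qp_sub x t) : R)%:E = 1)%E}.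

Definition isometric_bijection (f : QP -> QP) :=
  bijective f /\ forall x y, absp (qp_sub (f x) (f y)) = absp (qp_sub x y).

End Qp.

(* Main.v *)
(** Say that two digit expansions agree below [n] when their digits at all positions [< n]
coincide; balls and valuations of differences are read off this relation.  A set [S] is a
tree with set of orders [J] when two elements of [S] first differ at a position of [J], and
when at each position of [J] every element of [S] branches in all [p] directions.  If [J] is
bounded above, the trees with orders [J] are exactly the isometric images of
[{x | supp x \subset J}].  A [p]-homogeneous set is a tree for [I = I_Omega], so both parts
reduce to a characterization of trees: spectra are the trees with orders [-I-1], tiling
complements those with orders [~ I].

Spectra.  The sum of a character over the balls of [Omega] vanishes as soon as the digit it
detects branches, because shifting that digit multiplies the sum by a nontrivial root of
unity; conversely irreducibility of the cyclotomic polynomials of prime power order shows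
that a vanishing sum forces branching.  Hence orthogonality means that differences have
orders in [-I-1].  Comparing the indicator of a ball with its orthogonal projection counts
the frequencies in a large ball, and a set splitting only at positions of [J] that has as
many classes as a tree is a tree.  For the converse the roles of [Omega] and [Lambda] are
exchanged in the vanishing sums, which recovers indicators of balls from characters.

Tilings.  By Tijdeman's argument ([A(X)^q = A(X^q)] modulo a prime [q]), a tiling [A + B] of
[Z/p^L] gives a tiling [k A + B] for each [k] prime to [p]; so a common order of [Omega] and
[T] would produce a collision, and the same counting gives branching. *)
Require Import Defs.
From HB Require Import structures.
From Stdlib Require Import ClassicalEpsilon.
From mathcomp Require Import all_boot all_order all_algebra.
From mathcomp Require Import cyclotomic algC complex.
From mathcomp Require Import all_classical all_reals all_analysis.
From mathcomp Require Import measurable_realfun.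
From mathcomp Require Import zify ring lra.
Set Implicit Arguments. Unset Strict Implicit. Unset Printing Implicit Defensive.
Import Order.TTheory GRing.Theory Num.Theory.
Local Open Scope classical_set_scope.
Local Open Scope ring_scope.

(** * Digits and truncations *)

Section Digits.
Variables (p : nat) (p_gt0 : (0 < p)%N).
Local Notation QP := (QP_ p_gt0).
Implicit Types (x y z : QP) (N n : int) (k : nat).

Lemma digit_lt x n : (digit x n < p)%N.
Proof. by case: x => d []. Qed.

Lemma digit_ext x y : digit x =1 digit y -> x = y.
Proof.
case: x y => [d dP] [e eP] /= /funext de.
by move: dP eP; rewrite de => dP eP; rewrite (proof_irrelevance _ dP eP).
Qed.

Definition zero_below N x := forall j, j < N -> digit x j = 0%N.

Lemma zero_below_exists x : exists N, zero_below N x.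
Proof. by case: x => d []. Qed.

Lemma zero_below_lb x : zero_below (lb x) x.
Proof.
apply: (epsilon_spec (inhabits (0 : int)) (fun N => zero_below N x)).
exact: zero_below_exists.
Qed.

Lemma zero_below_le N N' x : N <= N' -> zero_below N' x -> zero_below N x.
Proof. by move=> NN' N'x j jN; apply: N'x; exact: lt_le_trans NN'. Qed.

Lemma zero_below2 n x y : exists N, [/\ N <= n, zero_below N x & zero_below N y].
Proof.
exists (Num.min n (Num.min (lb x) (lb y))).
by split; [|apply: zero_below_le (@zero_below_lb x)|apply: zero_below_le (@zero_below_lb y)]; lia.
Qed.

Lemma zero_below_level n x : exists n', n <= n' /\ zero_below (- n') x.
Proof.
have [N [Nn Nx _]] := zero_below2 (- n) x x; exists (- N).
by rewrite opprK; split=> //; lia.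
Qed.

Definition agree n x y := forall j, j < n -> digit x j = digit y j.

Lemma agree_refl n x : agree n x x.
Proof. by []. Qed.

Lemma agree_sym n x y : agree n x y -> agree n y x.
Proof. by move=> xy j /xy. Qed.

Lemma agree_trans n y x z : agree n x y -> agree n y z -> agree n x z.
Proof. by move=> xy yz j jn; rewrite xy ?yz. Qed.

Lemma agree_le n n' x y : n <= n' -> agree n' x y -> agree n x y.
Proof. by move=> nn' xy j jn; apply: xy; exact: lt_le_trans nn'. Qed.

Lemma agreeS n x y : agree n x y -> digit x n = digit y n -> agree (n + 1) x y.
Proof.
move=> xy xyn j jn; have [/xy//|nj] := ltP j n.
by have -> : j = n by lia.
Qed.

Lemma agree_zero_below N x y : agree N x y -> zero_below N x -> zero_below N y.
Proof. by move=> xy Nx j jN; rewrite -xy ?Nx. Qed.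

Lemma zero_below_agree N x y : zero_below N x -> zero_below N y -> agree N x y.
Proof. by move=> Nx Ny j jN; rewrite Nx ?Ny. Qed.

Lemma agree_eq x y : (forall n, agree n x y) -> x = y.
Proof. by move=> xy; apply: digit_ext => j; apply: (xy (j + 1)); lia. Qed.

Lemma agree_ind N n x y : agree N x y ->
  (forall j, N <= j < n -> agree j x y -> digit x j = digit y j) -> agree n x y.
Proof.
move=> xyN ind; have [nN|/ltW Nn] := leP n N; first exact: agree_le xyN.
have agree_up k : N + k%:Z <= n -> agree (N + k%:Z) x y.
  elim: k => [_|k IH kn]; first by rewrite addr0.
  have -> : N + k.+1%:Z = N + k%:Z + 1 by lia.
  have xyk : agree (N + k%:Z) x y by apply: IH; lia.
  by apply: agreeS => //; apply: ind => //; lia.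
have nE : n = N + `|n - N|%N%:Z by lia.
by rewrite nE; apply: agree_up; lia.
Qed.

Lemma first_difference n x y : ~ agree n x y ->
  exists j, [/\ j < n, agree j x y & digit x j <> digit y j].
Proof.
move=> nxy; have [N [Nn Nx Ny]] := zero_below2 n x y.
apply: contrapT => nk; apply: nxy; apply: (agree_ind (zero_below_agree Nx Ny)) => j /andP[_ jn] xyj.
by apply: contrapT => dj; apply: nk; exists j.
Qed.

Lemma first_difference_neq x y : x <> y ->
  exists j, agree j x y /\ digit x j <> digit y j.
Proof.
move=> xy; have [n nxy] : exists n, ~ agree n x y.
  apply: contrapT => all_agree; apply: xy; apply: agree_eq => n.
  by apply: contrapT => nxy; apply: all_agree; exists n.
by have [k [_ xyk dk]] := first_difference nxy; exists k.
Qed.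

Definition block N k x : nat := \sum_(i < k) digit x (N + i%:Z) * p ^ i.

Lemma block0 N x : block N 0 x = 0%N. Proof. by rewrite /block big_ord0. Qed.

Lemma blockS N k x : block N k.+1 x = (block N k x + digit x (N + k%:Z) * p ^ k)%N.
Proof. by rewrite /block big_ord_recr. Qed.

Lemma block_cat N j k x : block N (j + k) x = (block N j x + p ^ j * block (N + j%:Z) k x)%N.
Proof.
elim: k => [|k IH]; first by rewrite addn0 block0 muln0 addn0.
by rewrite addnS !blockS IH mulnDr addnA expnD PoszD addrA mulnCA mulnA.
Qed.

Lemma block_lt N k x : (block N k x < p ^ k)%N.
Proof.
elim: k => [|k IH]; first by rewrite block0.
by rewrite blockS expnS; have := digit_lt x (N + k%:Z); nia.
Qed.

Lemma block_modn N j k x : (j <= k)%N -> (block N k x %% p ^ j = block N j x)%N.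
Proof.
move=> jk; rewrite -(subnKC jk) block_cat mulnC addnC modnMDl modn_small //.
exact: block_lt.
Qed.

Lemma agree_block N k x y : agree (N + k%:Z) x y -> block N k x = block N k y.
Proof. by move=> xy; apply: eq_bigr => i _; rewrite xy //; have := ltn_ord i; lia. Qed.

Lemma block_zero_below N k x : zero_below (N + k%:Z) x -> block N k x = 0%N.
Proof. by move=> Nx; apply: big1 => i _; rewrite Nx //; have := ltn_ord i; lia. Qed.

Lemma block_inj N k x y : zero_below N x -> zero_below N y -> block N k x = block N k y ->
  agree (N + k%:Z) x y.
Proof.
move=> Nx Ny; elim: k => [|k IH] Bxy; first by rewrite addr0; exact: zero_below_agree.
have Bk : block N k x = block N k y by rewrite -(block_modn N x (leqnSn k)) Bxy block_modn.
have -> : N + k.+1%:Z = (N + k%:Z) + 1 by lia.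
apply: agreeS; first exact: IH.
move: Bxy; rewrite !blockS Bk => /addnI/eqP; rewrite eqn_pmul2r ?expn_gt0 ?p_gt0 //.
by move/eqP.
Qed.

Lemma block_diff N L i x y : agree (N + i%:Z) x y -> digit x (N + i%:Z) <> digit y (N + i%:Z) ->
  (i < L)%N -> exists2 d : int, ~~ (p %| d)%Z &
    (block N L x)%:Z - (block N L y)%:Z = (p ^ i)%N%:Z * d.
Proof.
move=> xy dxy iL.
have blockE z : block N L z = (block N i z +
    p ^ i * (digit z (N + i%:Z) + p * block (N + i.+1%:Z) (L - i.+1) z))%N.
  rewrite -{1}(subnKC iL) block_cat blockS expnS mulnDr addnA [(digit _ _ * _)%N]mulnC mulnA.
  by rewrite [(p ^ i * p)%N]mulnC.
rewrite !blockE (agree_block xy); set a := digit x _; set b := digit y _.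
set c := block (_ + i.+1%:Z) _ x; set e := block (_ + i.+1%:Z) _ y.
exists ((a%:Z - b%:Z) + p%:Z * (c%:Z - e%:Z)); last by rewrite !PoszD !PoszM !PoszD !PoszM; ring.
rewrite rpredDr; last by rewrite dvdz_mulr.
apply/negP => /dvdzP[q qE]; apply: dxy; rewrite -/a -/b.
have := digit_lt x (N + i%:Z); have := digit_lt y (N + i%:Z); rewrite -/a -/b => bp ap.
have q0 : q = 0 by nia.
by lia.
Qed.

(* Starting at [min (lb x) n] rather than at [lb x] gives the partial sum of the expansion of
   [x] over the positions below [n] also when [n < lb x]. *)
Definition trunc n x : rat :=
  let N := Num.min (lb x) n in p%:R ^ N * (block N `|n - N| x)%:R.

Let p_neq0 : (p%:R : rat) != 0.
Proof. by rewrite pnatr_eq0 -lt0n. Qed.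

Let pX_gt0 n : 0 < (p%:R : rat) ^ n.
Proof. by rewrite exprz_gt0 ?ltr0n. Qed.

Let pX_unit n : (p%:R : rat) ^ n \is a GRing.unit.
Proof. by rewrite unitfE gt_eqF. Qed.

Lemma truncE N k x : zero_below N x -> trunc (N + k%:Z) x = p%:R ^ N * (block N k x)%:R.
Proof.
have rebase N1 j l : zero_below (N1 + j%:Z) x ->
    p%:R ^ N1 * (block N1 (j + l) x)%:R =
    p%:R ^ (N1 + j%:Z) * (block (N1 + j%:Z) l x)%:R :> rat.
  move=> N1x; rewrite block_cat block_zero_below // add0n natrM natrX mulrA.
  by rewrite (expfzDr _ _ p_neq0).
move=> Nx; rewrite /trunc; set n := N + k%:Z; set M := Num.min _ _.
have Mx : zero_below M x by apply: zero_below_le (@zero_below_lb x); rewrite /M; lia.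
have [MN|NM] := leP M N.
  have := @rebase M `|N - M|%N k; have -> : M + `|N - M|%N%:Z = N by lia.
  by move=> <- //; congr (_ * (block _ _ _)%:R); rewrite /n; lia.
have := @rebase N `|M - N|%N `|n - M|%N; have -> : N + `|M - N|%N%:Z = M by lia.
by move=> <- //; congr (_ * (block _ _ _)%:R); rewrite /n /M; lia.
Qed.

Lemma trunc_eq0 n x : zero_below n x -> trunc n x = 0.
Proof. by move=> nx; have := truncE 0 nx; rewrite addr0 block0 mulr0. Qed.

Lemma truncS n x : trunc (n + 1) x = trunc n x + (digit x n)%:R * p%:R ^ n.
Proof.
have [N [Nn Nx _]] := zero_below2 n x x.
have nE : n = N + `|n - N|%N%:Z by lia.
have -> : n + 1 = N + `|n - N|.+1%:Z by lia.
rewrite [in RHS]nE !truncE // blockS natrD natrM natrX mulrDr.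
by rewrite expfzDr // [p%:R ^ N * (_ * _)]mulrCA.
Qed.

Lemma trunc_ge0 n x : 0 <= trunc n x.
Proof. by rewrite mulr_ge0 // ltW. Qed.

Lemma trunc_lt n x : trunc n x < p%:R ^ n.
Proof.
have [N [Nn Nx _]] := zero_below2 n x x.
have -> : n = N + `|n - N|%N%:Z by lia.
by rewrite truncE // expfzDr // ltr_pM2l // -exprnP -natrX ltr_nat block_lt.
Qed.

Lemma agree_trunc n x y : agree n x y <-> trunc n x = trunc n y.
Proof.
have [N [Nn Nx Ny]] := zero_below2 n x y.
have -> : n = N + `|n - N|%N%:Z by lia.
rewrite !truncE //; split=> [/agree_block->//|/(mulrI (pX_unit N))/eqP].
by rewrite eqr_nat => /eqP; exact: block_inj.
Qed.

Definition eqmod n (q r : rat) : Prop := (q - r) / p%:R ^ n \is a Num.int.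

Lemma eqmod_refl n q : eqmod n q q.
Proof. by rewrite /eqmod subrr mul0r. Qed.

Lemma eqmod_sym n q r : eqmod n q r -> eqmod n r q.
Proof. by rewrite /eqmod -opprB mulNr rpredN. Qed.

Lemma eqmod_trans n r q s : eqmod n q r -> eqmod n r s -> eqmod n q s.
Proof. by move=> qr rs; have := rpredD qr rs; rewrite -mulrDl addrA subrK. Qed.

Lemma eqmodD n q r q' r' : eqmod n q r -> eqmod n q' r' -> eqmod n (q + q') (r + r').
Proof. by move=> qr qr'; rewrite /eqmod opprD addrACA mulrDl; exact: rpredD. Qed.

Lemma eqmod_addI n q r s : eqmod n (q + s) (r + s) -> eqmod n q r.
Proof. by rewrite /eqmod [r + s]addrC addrKA. Qed.

Lemma eqmodM n n' q r s : eqmod n q r -> eqmod n' s 0 -> eqmod (n + n') (s * q) (s * r).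
Proof.
rewrite /eqmod subr0 => qr s0; have -> : (s * q - s * r) / p%:R ^ (n + n') =
    (q - r) / p%:R ^ n * (s / p%:R ^ n').
  by rewrite expfzDr // invfM -mulrBr; ring.
exact: rpredM.
Qed.

Lemma eqmod_le n n' q r : n <= n' -> eqmod n' q r -> eqmod n q r.
Proof.
move=> nn' qr; rewrite /eqmod; have -> : n = n' - `|n' - n|%N%:Z by lia.
rewrite expfzDr // invfM [(_ ^ (- _))^-1]invr_expz opprK mulrA; apply: rpredM => //.
by rewrite -exprnP rpredX ?rpred_nat.
Qed.

Lemma eqmod_natM n a b : eqmod n (p%:R ^ n * a%:R) (p%:R ^ n * b%:R).
Proof. by rewrite /eqmod -mulrBr mulrC mulKf ?gt_eqF // rpredB ?rpred_nat. Qed.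

Lemma modn_eqmod a b : (a = b %[mod p])%N -> eqmod 1 a%:R b%:R.
Proof.
move=> ab; rewrite /eqmod expr1z (divn_eq a p) (divn_eq b p) ab !natrD !natrM.
by rewrite opprD addrACA subrr addr0 -mulrBl mulfK // rpredB ?rpred_nat.
Qed.

Lemma eqmod_trunc n x y : eqmod n (trunc n x) (trunc n y) <-> agree n x y.
Proof.
rewrite agree_trunc; split=> [|->]; last exact: eqmod_refl.
move=> /norm_intr_ge1 diff_ge1; apply/eqP; rewrite -subr_eq0; apply: contraT => diff0.
have := trunc_lt n x; have := trunc_lt n y; have := trunc_ge0 n x; have := trunc_ge0 n y.
have {diff_ge1} : 1 <= `|(trunc n x - trunc n y) / p%:R ^ n|.
  by apply: diff_ge1; rewrite mulf_neq0 ?invr_neq0 // gt_eqF.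
rewrite normrM normfV [`|_ ^ n|]gtr0_norm // ler_pdivlMr // mul1r.
by rewrite real_ler_normr ?num_real // => /orP[]; lra.
Qed.

Lemma eqmod_trunc0 n x : eqmod n (trunc n x) 0 <-> zero_below n x.
Proof.
have trunc0 : trunc n (qp_zero p_gt0) = 0 by apply: trunc_eq0.
by rewrite -trunc0 eqmod_trunc.
Qed.

Lemma trunc_mod m n x : m <= n -> eqmod m (trunc n x) (trunc m x).
Proof.
have trunc_up k : eqmod m (trunc (m + k%:Z) x) (trunc m x).
  elim: k => [|k IH]; first by rewrite addr0; exact: eqmod_refl.
  have -> : m + k.+1%:Z = m + k%:Z + 1 by lia.
  rewrite truncS -[X in eqmod _ _ X]addr0; apply: eqmodD IH _.
  apply: (@eqmod_le m (m + k%:Z)); first by lia.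
  by rewrite mulrC; have := eqmod_natM (m + k%:Z) (digit x (m + k%:Z)) 0; rewrite mulr0.
by move=> mn; have -> : n = m + `|n - m|%N%:Z by lia.
Qed.

Lemma trunc_mod0 N n x : zero_below N x -> eqmod N (trunc n x) 0.
Proof.
move=> Nx; have [nN|/ltW Nn] := leP n N.
  by rewrite trunc_eq0; [exact: eqmod_refl|exact: zero_below_le Nx].
by apply: eqmod_trans (trunc_mod x Nn) _; rewrite trunc_eq0 //; exact: eqmod_refl.
Qed.

End Digits.

Section Addition.
Variables (p : nat) (p_gt0 : (0 < p)%N).
Local Notation QP := (QP_ p_gt0).
Implicit Types (x y z : QP) (N n : int) (k : nat).

Lemma block_add_carry x y N k :
  (block N k (MkQP p_gt0 (add_raw_valid p_gt0 (digit x) (digit y) N))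
   + p ^ k * add_carry p (digit x) (digit y) N k)%N = (block N k x + block N k y)%N.
Proof.
elim: k => [|k IH]; first by rewrite !block0 /= muln0.
rewrite !blockS /=.
have -> : add_raw p (digit x) (digit y) N (N + k%:Z) =
   ((digit x (N + k%:Z) + digit y (N + k%:Z) + add_carry p (digit x) (digit y) N k) %% p)%N.
  rewrite /add_raw ifF; last by apply/negbTE; lia.
  by have -> : `|(N + k%:Z - N)%R|%N = k by lia.
move: IH; set c := add_carry _ _ _ _ _; set s := (_ + _ + c)%N => IH.
have := divn_eq s p; rewrite {1}/s expnS; set q := (s %/ p)%N; set r := (s %% p)%N.
nia.
Qed.

Lemma trunc_qp_add n x y : eqmod p n (trunc n (qp_add x y)) (trunc n x + trunc n y).
Proof.
set N : int := Num.min (lb x) (lb y).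
have Nx : zero_below N x by apply: zero_below_le (@zero_below_lb _ _ x); rewrite /N; lia.
have Ny : zero_below N y by apply: zero_below_le (@zero_below_lb _ _ y); rewrite /N; lia.
have Nxy : zero_below N (qp_add x y) by move=> j jN /=; rewrite /add_raw jN.
have [nN|/ltW Nn] := leP n N.
  by rewrite !trunc_eq0 ?addr0; [exact: eqmod_refl|apply: zero_below_le nN _..].
have -> : n = N + `|n - N|%N%:Z by lia.
set k := `|_|%N; rewrite !truncE // -mulrDr -natrD -(block_add_carry x y N k) natrD mulrDr.
apply: eqmod_sym; rewrite -[X in eqmod _ _ _ X]addr0; apply: eqmodD; first exact: eqmod_refl.
rewrite natrM natrX mulrA exprnP -expfzDr ?pnatr_eq0 -?lt0n //.
have := eqmod_natM p_gt0 (N + k%:Z) (add_carry p (digit x) (digit y) N k) 0.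
by rewrite mulr0.
Qed.

Lemma eqmod_trunc_eq x y : (forall n, eqmod p n (trunc n x) (trunc n y)) -> x = y.
Proof. by move=> xy; apply: agree_eq => n; apply/eqmod_trunc. Qed.

Lemma qp_addC : commutative (@qp_add p p_gt0).
Proof.
move=> x y; apply: eqmod_trunc_eq => n; apply: eqmod_trans (trunc_qp_add n x y) _.
by rewrite addrC; apply/eqmod_sym/trunc_qp_add.
Qed.

Lemma qp_addA : associative (@qp_add p p_gt0).
Proof.
move=> x y z; apply: eqmod_trunc_eq => n; apply: eqmod_trans (trunc_qp_add _ _ _) _.
apply: eqmod_trans (eqmodD (eqmod_refl _ _ _) (trunc_qp_add _ _ _)) _; rewrite addrA.
apply: eqmod_sym; apply: eqmod_trans (trunc_qp_add _ _ _) _.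
exact: eqmodD (trunc_qp_add _ _ _) (eqmod_refl _ _ _).
Qed.

Lemma qp_add0 : left_id (qp_zero p_gt0) (@qp_add p p_gt0).
Proof.
move=> x; apply: eqmod_trunc_eq => n; apply: eqmod_trans (trunc_qp_add _ _ _) _.
by rewrite (trunc_eq0 (x := qp_zero p_gt0)) // add0r; exact: eqmod_refl.
Qed.

(* The first nonzero digit [a] becomes [p - a], later ones [p - 1 - a]. *)
Definition opp_digit x (n : int) : nat :=
  (if `[< zero_below n x >] then (p - digit x n) %% p else p.-1 - digit x n)%N.

Lemma opp_digit_valid x : qp_valid p (opp_digit x).
Proof.
split=> [n|]; first by rewrite /opp_digit; case: ifP; [rewrite ltn_pmod|lia].
have [N Nx] := zero_below_exists x; exists N => n nN.
by rewrite /opp_digit Nx // subn0 modnn asboolT //; exact: zero_below_le (ltW nN) _.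
Qed.

Definition qp_opp x : QP := MkQP p_gt0 (opp_digit_valid x).

Lemma block_opp N k x : zero_below N x ->
  (block N k (qp_opp x) + block N k x)%N = (if `[< zero_below (N + k%:Z) x >] then 0 else p ^ k)%N.
Proof.
move=> Nx; elim: k => [|k IH]; first by rewrite !block0 addr0 asboolT.
rewrite !blockS addnACA IH -mulnDl /= /opp_digit; have xk_lt := digit_lt x (N + k%:Z).
have -> : N + k.+1%:Z = N + k%:Z + 1 by lia.
case: (asboolP (zero_below (N + k%:Z) x)) => [Nkx|Nkx]; last first.
  rewrite asboolF => [|/(zero_below_le _) Nk1x]; last by apply: Nkx; apply: Nk1x; lia.
  by rewrite subnK ?expnS; [nia|lia].
have [xk0|xk0] := posnP (digit x (N + k%:Z)).
  rewrite xk0 subn0 modnn asboolT // => j jN; have [/Nkx//|Nj] := ltP j (N + k%:Z).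
  by have -> : j = N + k%:Z by lia.
rewrite asboolF => [|Nk1x]; last by rewrite (Nk1x (N + k%:Z)) in xk0; lia.
by rewrite modn_small ?subnK ?expnS //; lia.
Qed.

Lemma qp_addN : left_inverse (qp_zero p_gt0) qp_opp (@qp_add p p_gt0).
Proof.
move=> x; apply: eqmod_trunc_eq => n; apply: eqmod_trans (trunc_qp_add _ _ _) _.
rewrite [trunc n (qp_zero _)]trunc_eq0 //.
have [N [Nn Nx Nx']] := zero_below2 n x (qp_opp x).
have -> : n = N + `|n - N|%N%:Z by lia.
rewrite !truncE // -mulrDr -natrD block_opp //.
set k := `|_|%N; case: ifP => _; first by rewrite mulr0; exact: eqmod_refl.
rewrite natrX exprnP -expfzDr ?pnatr_eq0 -?lt0n //.
by have := eqmod_natM p_gt0 (N + k%:Z) 1 0; rewrite mulr0 mulr1.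
Qed.

HB.instance Definition _ := GRing.isZmodule.Build QP qp_addA qp_addC qp_add0 qp_addN.

Lemma qp_subE x y : qp_sub x y = x - y.
Proof.
have sub_spec : qp_sub x y + y = x.
  apply: (epsilon_spec (inhabits _) (fun z => qp_add z y = x)).
  by exists (x - y); exact: subrK.
by rewrite -[in RHS]sub_spec addrK.
Qed.

Lemma truncD n x y : eqmod p n (trunc n (x + y)) (trunc n x + trunc n y).
Proof. exact: trunc_qp_add. Qed.

Lemma agreeP n x y : agree n x y <-> zero_below n (x - y).
Proof.
have trunc_sub : eqmod p n (trunc n (x - y) + trunc n y) (trunc n x).
  by rewrite -[in trunc n x](subrK y x); apply/eqmod_sym/truncD.
rewrite -eqmod_trunc -eqmod_trunc0; split=> [xy|/eqmodD sub0].
  apply: (@eqmod_addI _ _ _ _ (trunc n y)).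
  by rewrite add0r; exact: eqmod_trans trunc_sub xy.
apply: eqmod_trans (eqmod_sym trunc_sub) _; rewrite -[X in eqmod _ _ _ X]add0r.
by apply: sub0; exact: eqmod_refl.
Qed.

Lemma zero_belowD n x y : zero_below n x -> zero_below n y -> zero_below n (x + y).
Proof.
by move=> nx ny; apply/eqmod_trunc0; apply: eqmod_trans (truncD _ _ _) _;
  rewrite !trunc_eq0 // addr0; exact: eqmod_refl.
Qed.

Lemma zero_belowB n x y : zero_below n x -> zero_below n y -> zero_below n (x - y).
Proof. by move=> nx ny; apply/agreeP; exact: zero_below_agree. Qed.

Lemma agreeDr n x y t : agree n (x + t) (y + t) <-> agree n x y.
Proof. by rewrite !agreeP opprD addrACA subrr addr0. Qed.

Lemma agreeBl n x t t' : agree n (x - t) (x - t') <-> agree n t t'.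
Proof.
by rewrite !agreeP opprB addrC addrA subrK -agreeP -[zero_below n _](agreeP n t' t);
  split; exact: agree_sym.
Qed.

Lemma agree_subl n x y t : agree n (x - t) y <-> agree n x (y + t).
Proof. by rewrite -(agreeDr n (x - t) y t) subrK. Qed.

Lemma digitB n x y : agree n x y ->
  eqmod p 1 (digit (x - y) n)%:R ((digit x n)%:R - (digit y n)%:R).
Proof.
move=> xy; have /trunc_eq0 sub0 : zero_below n (x - y) by apply/agreeP.
have := truncD (n + 1) (x - y) y; rewrite subrK !truncS sub0 add0r (iffLR (agree_trunc _ _ _) xy).
have p0 : (p%:R : rat) != 0 by rewrite pnatr_eq0 -lt0n.
rewrite /eqmod -rpredN; congr (is_true (in_mem _ _)).
have pn0 : (p%:R : rat) ^ n != 0 by rewrite expfz_neq0.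
by rewrite expfzDr // expr1z; field; rewrite p0 pn0.
Qed.

Lemma digitB_neq0 n x y : agree n x y -> digit x n <> digit y n -> digit (x - y) n <> 0%N.
Proof.
move=> xy dxy d0; apply: dxy; have : agree (n + 1) x y.
  apply/agreeP => j jn; have [/(iffLR (agreeP _ _ _) xy)//|nj] := ltP j n.
  by have -> : j = n by lia.
by apply; lia.
Qed.

Lemma zero_belowN n x : zero_below n x -> zero_below n (- x).
Proof. by move=> nx; rewrite -sub0r; apply: zero_belowB. Qed.

Lemma eqmod_natMP N k a b :
  eqmod p (N + k%:Z) (p%:R ^ N * a%:R) (p%:R ^ N * b%:R) -> (a = b %[mod p ^ k])%N.
Proof.
have p0 : (p%:R : rat) != 0 by rewrite pnatr_eq0 -lt0n.
have pN0 : (p%:R : rat) ^ N != 0 by rewrite expfz_neq0.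
rewrite /eqmod -mulrBr expfzDr // -mulf_div divff // mul1r => /intrP[c].
move=> /(congr1 (fun q => q * p%:R ^ k%:Z)); rewrite divfK ?expfz_neq0 // => abE.
apply/eqP; rewrite -eqz_nat -!modz_nat eqz_mod_dvd; apply/dvdzP; exists c.
by apply/eqP; rewrite -(eqr_int rat) rmorphB rmorphM /= -!pmulrn natrX abE.
Qed.

Lemma blockD N k x y : zero_below N x -> zero_below N y ->
  (block N k (x + y)%R = block N k x + block N k y %[mod p ^ k])%N.
Proof.
move=> Nx Ny; apply: (@eqmod_natMP N); rewrite natrD mulrDr.
by rewrite -(truncE k Nx) -(truncE k Ny) -(truncE k (zero_belowD Nx Ny)); exact: truncD.
Qed.

Lemma digit_add_nocarry x y : (forall j, digit x j + digit y j < p)%N ->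
  forall j, digit (x + y) j = (digit x j + digit y j)%N.
Proof.
move=> xy_lt j; rewrite /= /add_raw.
set N := Num.min _ _.
have carry0 k : add_carry p (digit x) (digit y) N k = 0%N.
  by elim: k => //= k ->; rewrite addn0 divn_small.
case: ifP => [jN|_]; last by rewrite carry0 addn0 modn_small.
by rewrite !zero_below_lb //; move: jN; rewrite /N; lia.
Qed.

End Addition.

Section DigitSums.
Variables (p : nat) (p_gt0 : (0 < p)%N).
Local Notation QP := (QP_ p_gt0).
Local Notation mono := (@qp_mono _ p_gt0).
Implicit Types (x : QP) (I J : set int).

Definition suppset J : set QP := [set x | forall j, ~ J j -> digit x j = 0%N].

Lemma digit_sum_mono (e : int -> int) (a : int -> 'I_p) (s : seq int) (j : int) :
  involutive e -> uniq s ->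
  digit (foldr (fun i acc => qp_add (mono (a i) (e i)) acc) (qp_zero p_gt0) s) j =
  if e j \in s then a (e j) : nat else 0%N.
Proof.
move=> eK; elim: s j => [|i s IH] //= j /andP[si us].
set sum := foldr _ _ s in IH *.
have nocarry l : (digit (mono (a i) (e i)) l + digit sum l < p)%N.
  rewrite IH //=; case: eqP => [->|_]; last by rewrite add0n; case: ifP.
  by rewrite eK (negbTE si) addn0.
have := digit_add_nocarry nocarry j; rewrite /= => ->; rewrite IH // inE.
have -> : (j == e i) = (e j == i) by apply/eqP/eqP => [->|<-]; rewrite eK.
by case: eqP => [->|_] //=; rewrite (negbTE si) addn0.
Qed.

Lemma digit_sumsetE I (e : int -> int) (b : int) :
  involutive e -> (forall j, I (e j) -> j < b) ->
  digit_sumset I e = suppset (e @^-1` I).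
Proof.
move=> eK eI_lt; apply/seteqP; split=> [x [s [a [us [sI ->]]]] j nJ /=|x xJ].
  by rewrite digit_sum_mono //; case: ifP => // /sI.
have [N Nx] := zero_below_exists x.
pose s := [seq e (N + k%:Z) | k <- iota 0 `|b - N|%N & `[< I (e (N + k%:Z)) >]].
have us : uniq s.
  by rewrite map_inj_uniq ?filter_uniq ?iota_uniq // => k l /(can_inj eK)/addrI[].
exists s, (fun i => Ordinal (digit_lt x (e i))); split=> //; split.
  by move=> i /mapP[k]; rewrite mem_filter => /andP[/asboolP ? _] ->.
apply: digit_ext => j; rewrite digit_sum_mono // /= eK.
case: ifPn => // /negP js; have [Ij|/xJ//] := pselect (I (e j)).
have [/Nx//|Nj] := ltP j N; have jb := eI_lt _ Ij.
have jE : N + `|j - N|%N%:Z = j by lia.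
exfalso; apply: js; apply/mapP; exists `|j - N|%N; rewrite ?jE //.
by rewrite mem_filter mem_iota jE; apply/andP; split; [exact/asboolP|lia].
Qed.

End DigitSums.

(** * Metric and fractional part of a product *)

Section Metric.
Variables (p : nat) (p_gt0 : (0 < p)%N).
Hypothesis p_gt1 : (1 < p)%N.
Local Notation QP := (QP_ p_gt0).
Implicit Types (x y z : QP) (N n : int) (k : nat).

Lemma vpP z : z <> 0 -> digit z (vp z) <> 0%N /\ zero_below (vp z) z.
Proof.
move=> z0; apply: (epsilon_spec (inhabits (0 : int))
  (fun v => digit z v <> 0%N /\ forall n, n < v -> digit z n = 0%N)).
by have [n [nz dz]] := first_difference_neq z0; exists n.
Qed.

Lemma zero_below_vp z n : z <> 0 -> zero_below n z <-> n <= vp z.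
Proof.
move=> /vpP[dz vz]; split=> [nz|le]; last exact: zero_below_le vz.
by rewrite leNgt; apply/negP => /nz.
Qed.

Lemma zero_below_eq0 z : (forall n, zero_below n z) -> z = 0.
Proof. by move=> nz; apply: digit_ext => j; apply: (nz (j + 1)); lia. Qed.

Lemma absp_le z n : absp z <= p%:R ^ (- n) <-> zero_below n z.
Proof.
rewrite /absp; case: eqP => [->|z0]; first by split=> // _; apply: exprz_ge0.
rewrite zero_below_vp // ler_eXz2l ?ltr1n //; split; lia.
Qed.

Lemma absp_eq z z' : (forall n, zero_below n z <-> zero_below n z') -> absp z = absp z'.
Proof.
move=> zz'; rewrite /absp; case: eqP => z0; case: eqP => z0' //.
- by case: z0'; apply: zero_below_eq0 => n; apply/zz'; rewrite z0.
- by case: z0; apply: zero_below_eq0 => n; apply/zz'; rewrite z0'.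
suff -> : vp z = vp z' by [].
by apply/eqP; rewrite eq_le; apply/andP; split;
  apply/zero_below_vp => //; apply/zz'/zero_below_vp.
Qed.

Lemma vp_subP x y n :
  (x <> y /\ vp (qp_sub x y) = n) <-> (agree n x y /\ digit x n <> digit y n).
Proof.
have sub0 : x <> y -> qp_sub x y <> 0 by rewrite qp_subE => xy /subr0_eq.
split=> [[xy <-]|[nxy dxy]].
  have [dz vz] := vpP (sub0 xy); have vxy : agree (vp (qp_sub x y)) x y.
    by apply/agreeP; rewrite -qp_subE.
  split=> // dxy; apply: dz.
  have /agreeP := agreeS vxy dxy; rewrite -qp_subE => /(_ (vp (qp_sub x y))); apply; lia.
have xy : x <> y by move=> xy; rewrite xy in dxy.
split=> //; apply/eqP; rewrite eq_le; apply/andP; split.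
  rewrite leNgt; apply/negP => lt; apply: dxy.
  have [_] := vpP (sub0 xy); rewrite [X in zero_below _ X]qp_subE => /agreeP; exact.
by apply/zero_below_vp; [exact: sub0|rewrite qp_subE; apply/agreeP].
Qed.

Lemma qp_ballE x n : qp_ball x n = [set y | agree n y x].
Proof. by apply/seteqP; split=> y /=; rewrite agreeP -qp_subE -absp_le. Qed.

Lemma isometryP (f : QP -> QP) :
  (forall x y, absp (qp_sub (f x) (f y)) = absp (qp_sub x y)) <->
  (forall n x y, agree n (f x) (f y) <-> agree n x y).
Proof.
split=> [fiso n x y|fiso x y]; first by rewrite !agreeP -!qp_subE -!absp_le fiso.
by apply: absp_eq => n; rewrite !qp_subE -!agreeP.
Qed.

Lemma sum_conv_block x y Nx Ny k :
  (\sum_(m < k) Defs.conv (digit x) (digit y) Nx Ny m * p ^ m =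
   \sum_(i < k) digit x (Nx + i%:Z) * p ^ i * block Ny (k - i) y)%N.
Proof.
elim: k => [|k IH]; first by rewrite !big_ord0.
rewrite big_ord_recr /= {}IH [RHS]big_ord_recr /= subSn // subnn blockS block0 expn0.
rewrite muln1 add0n addr0 /Defs.conv big_ord_recr /= mulnDl addnA subnn addr0.
congr (_ + _)%N; last by rewrite mulnAC.
rewrite big_distrl /= -big_split; apply: eq_bigr => i _ /=.
have ik : (i <= k)%N by apply: ltnW.
rewrite subSn // blockS mulnDr; congr (_ + _)%N.
have -> : (p ^ k = p ^ i * p ^ (k - i))%N by rewrite -expnD subnKC.
exact: mulnACA.
Qed.

Lemma sum_conv_modn x y Nx Ny k :
  (\sum_(m < k) Defs.conv (digit x) (digit y) Nx Ny m * p ^ m =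
   block Nx k x * block Ny k y %[mod p ^ k])%N.
Proof.
rewrite sum_conv_block /block big_distrl /=.
elim/big_rec2: _ => // i a b _ ab.
rewrite -modnDm -[RHS]modnDm ab; congr ((_ + _) %% _)%N; rewrite -/(block Ny k y).
have ik : (i <= k)%N by apply: ltnW.
have -> : (p ^ k = p ^ i * p ^ (k - i))%N by rewrite -expnD subnKC.
rewrite -/(block Ny (k - i) y) [(digit _ _ * p ^ i)%N]mulnC -!mulnA -!muln_modr.
by congr (_ * _)%N; rewrite -[RHS]modnMmr block_modn ?leq_subr.
Qed.

Lemma block_mul_carry x y Nx Ny k :
  (block (Nx + Ny) k (MkQP p_gt0 (mul_raw_valid p_gt0 (digit x) (digit y) Nx Ny))
   + p ^ k * mul_carry p (digit x) (digit y) Nx Ny k =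
   \sum_(m < k) Defs.conv (digit x) (digit y) Nx Ny m * p ^ m)%N.
Proof.
elim: k => [|k IH]; first by rewrite !block0 big_ord0 muln0.
rewrite !blockS big_ord_recr /=.
have -> : mul_raw p (digit x) (digit y) Nx Ny (Nx + Ny + k%:Z) =
   ((Defs.conv (digit x) (digit y) Nx Ny k + mul_carry p (digit x) (digit y) Nx Ny k) %% p)%N.
  rewrite /mul_raw ifF; last by apply/negbTE; lia.
  by have -> : `|(Nx + Ny + k%:Z - (Nx + Ny))%R|%N = k by lia.
move: IH; set c := mul_carry _ _ _ _ _ _; set t := Defs.conv _ _ _ _ _; set s := (t + c)%N => IH.
have := divn_eq s p; rewrite {1}/s expnS; set q := (s %/ p)%N; set r := (s %% p)%N.
move=> tcE; rewrite -IH.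
have : ((t + c) * p ^ k = (q * p + r) * p ^ k)%N by rewrite tcE.
by clear; set w := block _ _ _; move: w (p ^ k)%N => w P; nia.
Qed.

Lemma trunc_mul_lb x y k :
  eqmod p (lb x + lb y + k%:Z) (trunc (lb x + lb y + k%:Z) (qp_mul x y))
    (trunc (lb x + k%:Z) x * trunc (lb y + k%:Z) y).
Proof.
have Nxy : zero_below (lb x + lb y) (qp_mul x y) by move=> j jN /=; rewrite /mul_raw jN.
have p0 : (p%:R : rat) != 0 by rewrite pnatr_eq0 -lt0n.
rewrite (truncE _ Nxy) (truncE _ (@zero_below_lb _ _ x)) (truncE _ (@zero_below_lb _ _ y)).
rewrite mulrACA -(expfzDr _ _ p0) -natrM.
have [c cE] : exists c : int, (block (lb x + lb y) k (qp_mul x y))%:Z =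
    (block (lb x) k x * block (lb y) k y)%N%:Z + c * (p ^ k)%N%:Z.
  have /eqP := sum_conv_modn x y (lb x) (lb y) k; rewrite -block_mul_carry addnC mulnC modnMDl.
  rewrite -eqz_nat -!modz_nat eqz_mod_dvd => /dvdzP[c cE]; exists c.
  by rewrite -cE addrCA subrr addr0.
rewrite /eqmod -mulrBr [p%:R ^ (_ + k%:Z)]expfzDr //.
have -> : (block (lb x + lb y) k (qp_mul x y))%:R - (block (lb x) k x * block (lb y) k y)%:R =
    c%:~R * p%:R ^+ k :> rat.
  by rewrite -natrX !pmulrn -rmorphM -rmorphB /= cE addrAC subrr add0r.
by rewrite mulrCA exprnP mulfK // mulf_neq0 ?expfz_neq0.
Qed.

Lemma frac_trunc z : Defs.frac z = trunc 0 z.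
Proof.
have p0 : (p%:R : rat) != 0 by rewrite pnatr_eq0 -lt0n.
rewrite /Defs.frac; have [lb0|/ltW lb0] := leP 0 (lb z).
  rewrite absz0 big_ord0 trunc_eq0 //.
  exact: zero_below_le lb0 (@zero_below_lb _ _ z).
have -> : 0 = lb z + `|lb z|%N%:Z by lia.
rewrite (truncE _ (@zero_below_lb _ _ z)) /block natr_sum mulr_sumr.
by apply: eq_bigr => i _; rewrite natrM natrX mulrCA expfzDr.
Qed.

Lemma frac_mul x y N M : zero_below N x -> zero_below M y ->
  eqmod p 0 (Defs.frac (qp_mul x y)) (trunc (- M) x * trunc (- N) y).
Proof.
move=> Nx My; pose k := (`|lb x| + `|lb y| + `|N| + `|M|)%N; rewrite frac_trunc.
apply: (@eqmod_trans _ _ (trunc (lb x + lb y + k%:Z) (qp_mul x y))).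
  by apply: eqmod_sym; apply: trunc_mod; rewrite /k; lia.
apply: (@eqmod_trans _ _ (trunc (lb x + k%:Z) x * trunc (lb y + k%:Z) y)).
  by apply: eqmod_le (trunc_mul_lb x y k); rewrite /k; lia.
have -> : 0 = - M + M by lia.
apply: (@eqmod_trans _ _ (trunc (- M) x * trunc (lb y + k%:Z) y)).
  rewrite [trunc _ x * _]mulrC [X in eqmod _ _ _ X]mulrC.
  by apply: eqmodM => //; [apply: trunc_mod; rewrite /k; lia|exact: trunc_mod0].
have -> : - M + M = - N + N by lia.
by apply: eqmodM => //; [apply: trunc_mod; rewrite /k; lia|exact: trunc_mod0].
Qed.

End Metric.

(** * Trees *)

Section Trees.
Variables (p : nat) (p_gt0 : (0 < p)%N).
Local Notation QP := (QP_ p_gt0).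
Implicit Types (x y : QP) (N n : int) (L : nat) (J : set int) (S : set QP).

Definition splits_within J S := forall s s' n, S s -> S s' ->
  agree n s s' -> ~ J n -> digit s n = digit s' n.

Definition branches_at J S := forall s n (d : 'I_p), S s -> J n ->
  exists s', [/\ S s', agree n s s' & digit s' n = d].

Definition tree J S := [/\ S !=set0, splits_within J S & branches_at J S].

Lemma splits_within_agree J S s s' n : splits_within J S -> S s -> S s' ->
  (forall j, j < n -> J j -> digit s j = digit s' j) -> agree n s s'.
Proof.
move=> split_S Ss Ss' ss'J; have [N [Nn Ns Ns']] := zero_below2 n s s'.
apply: (agree_ind (zero_below_agree Ns Ns')) => j /andP[_ jn] ss'.
by have [Jj|nJ] := pselect (J j); [exact: ss'J|exact: split_S ss' nJ].
Qed.

Lemma set_digit_valid x n (d : 'I_p) : qp_valid p (fun j => if j == n then d : nat else digit x j).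
Proof.
split=> [j|]; first by case: ifP => // _; exact: digit_lt.
have [N Nx] := zero_below_exists x; exists (Num.min N n) => j jN.
by rewrite ifF ?Nx //; [lia|apply/eqP; lia].
Qed.

Definition set_digit x n (d : 'I_p) : QP := MkQP p_gt0 (set_digit_valid x n d).

Lemma digit_set_digit x n d : digit (set_digit x n d) n = d.
Proof. by rewrite /= eqxx. Qed.

Lemma set_digit_agree x n d : agree n x (set_digit x n d).
Proof. by move=> j jn /=; rewrite lt_eqF. Qed.

Lemma tree_realize J S s0 N n x : tree J S -> S s0 -> zero_below N s0 ->
  exists s, [/\ S s, zero_below N s & forall j, N <= j < n -> J j -> digit s j = digit x j].
Proof.
move=> [_ _ branch_S] Ss0 Ns0.
have realize_up k : exists s, [/\ S s, zero_below N s &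
    forall j, N <= j < N + k%:Z -> J j -> digit s j = digit x j].
  elim: k => [|k [s [Ss Ns sx]]]; first by exists s0; split=> // j; lia.
  have last_digit j : N <= j < N + k.+1%:Z -> j <> N + k%:Z -> N <= j < N + k%:Z by lia.
  have [Jk|nJk] := pselect (J (N + k%:Z)); last first.
    by exists s; split=> // j /last_digit jk Jj; apply: sx => //; apply: jk => jE; rewrite jE in Jj.
  have [s' [Ss' ss' s'k]] := branch_S s _ (Ordinal (digit_lt x (N + k%:Z))) Ss Jk.
  exists s'; split=> //; first by apply: agree_zero_below Ns; apply: agree_le ss'; lia.
  move=> j jk Jj; have [->//|/eqP/(last_digit _ jk)/andP[Nj jNk]] := eqVneq j (N + k%:Z).
  by rewrite -ss' ?sx // Nj.
have [s [Ss Ns sx]] := realize_up `|n - N|%N.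
by exists s; split=> // j /andP[Nj jn]; apply: sx; lia.
Qed.

Lemma tree_setT : tree [set: int] [set: QP].
Proof.
split=> [|s s' n _ _ _ //|s n d _ _]; first by exists 0.
by exists (set_digit s n d); split=> //; [exact: set_digit_agree|exact: digit_set_digit].
Qed.

Definition cylinder N n S := S `<=` zero_below N /\ forall x y, S x -> agree n x y -> S y.

Lemma cylinder_le N n n' S : n <= n' -> cylinder N n S -> cylinder N n' S.
Proof. by move=> nn' [SN Sn]; split=> // x y Sx xy; apply: Sn Sx _; exact: agree_le xy. Qed.

Lemma tree_orders_ge J S N j : (1 < p)%N -> tree J S -> S `<=` zero_below N -> J j -> N <= j.
Proof.
move=> p_gt1 [[s Ss] _ branch_S] SN Jj; rewrite leNgt; apply/negP => jN.
have [s' [/SN/(_ _ jN) s'0 _]] := branch_S s j (Ordinal p_gt1) Ss Jj.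
by rewrite s'0.
Qed.

Lemma tree_cylinder_orders J S N n j : (1 < p)%N -> tree J S -> cylinder N n S -> n <= j -> J j.
Proof.
move=> p_gt1 [[s Ss] split_S _] [_ Sn] nj; apply: contrapT => nJ.
have [d /eqP ds] : exists d : 'I_p, nat_of_ord d != digit s j.
  by case: (digit s j) => [|k]; [exists (Ordinal p_gt1)|exists (Ordinal p_gt0)].
have ss' : agree j s (set_digit s j d) by exact: set_digit_agree.
have Ss' : S (set_digit s j d) by apply: Sn Ss _; exact: agree_le ss'.
by have := split_S _ _ _ Ss Ss' ss' nJ; rewrite digit_set_digit => /esym.
Qed.

End Trees.

(** * Transversals *)

Section Transversals.
Variables (p : nat) (p_gt0 : (0 < p)%N).
Local Notation QP := (QP_ p_gt0).
Implicit Types (x y : QP) (N n : int) (L : nat) (J : set int) (S : set QP).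

Definition transversal n S (F : finType) (a : F -> QP) :=
  [/\ forall g, S (a g), forall x, S x -> exists g, agree n x (a g) &
      forall g g', agree n (a g) (a g') -> g = g'].

Lemma transversal_exists N n S : S `<=` zero_below N ->
  exists (F : finType) (a : F -> QP), transversal n S a.
Proof.
move=> SN; pose M := Num.min N n; pose L := `|n - M|%N.
have nE : n = M + L%:Z by rewrite /L /M; lia.
have SM : S `<=` zero_below M by move=> x /SN; apply: zero_below_le; rewrite /M; lia.
pose F := {b : 'I_(p ^ L) | `[< exists2 s, S s & block M L s = b >]}.
have block_rep (b : F) : exists s, S s /\ block M L s = val b.
  by have /asboolP[s] := valP b; exists s.
have [a aP] := choice block_rep; exists F, a; split=> [b|x Sx|b b' ab]; first by have [] := aP b.
  have bP : `[< exists2 s, S s & block M L s = Ordinal (block_lt M L x) >].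
    by apply/asboolP; exists x.
  exists (exist _ (Ordinal (block_lt M L x)) bP); rewrite nE.
  have [Sb /esym bE] := aP (exist _ (Ordinal (block_lt M L x)) bP).
  exact: block_inj (SM _ Sx) (SM _ Sb) bE.
have [[_ bE] [_ bE']] := (aP b, aP b'); apply/val_inj/val_inj; rewrite /= -bE -bE'.
by apply: agree_block; rewrite -nE.
Qed.

Lemma transversal_shift N n J S (F : finType) (a : F -> QP) r :
  splits_within J S -> branches_at J S -> transversal n (S `&` zero_below N) a ->
  J r -> N <= r < n ->
  exists2 t : F -> F, injective t & forall g, agree r (a g) (a (t g)) /\
    digit (a (t g)) r = ((digit (a g) r + 1) %% p)%N.
Proof.
move=> split_S branch_S [Sa cover_a inj_a] Jr Nrn.
pose inc x : 'I_p := Ordinal (ltn_pmod (digit x r + 1) p_gt0).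
have [t tP] : exists t : F -> F, forall g j, N <= j < n -> J j ->
    digit (a (t g)) j = digit (set_digit (a g) r (inc (a g))) j.
  have shift_at g : exists g', forall j, N <= j < n -> J j ->
      digit (a g') j = digit (set_digit (a g) r (inc (a g))) j.
    have [Sg Ng] := Sa g; have tS : tree J S by split=> //; exists (a g).
    have [s [Ss Ns sx]] := tree_realize n (set_digit (a g) r (inc (a g))) tS Sg Ng.
    have [g' sg'] := cover_a s (conj Ss Ns).
    by exists g' => j jn Jj; rewrite -sg' ?sx //; case/andP: jn.
  by have [t tP] := choice shift_at; exists t.
have below_N g g' j : j < N -> digit (a g) j = digit (a g') j.
  by move=> jN; rewrite (Sa g).2 ?(Sa g').2.
have [Nr rn] := andP Nrn.
exists t => [g g' tgg'|g].
  apply: inj_a; apply: (splits_within_agree split_S (Sa g).1 (Sa g').1) => j jn Jj.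
  have [jN|Nj] := ltP j N; first exact: below_N.
  have jNn : N <= j < n by rewrite Nj.
  have := tP g j jNn Jj; rewrite tgg' tP //= => /esym; case: eqP => [->|//].
  move=> /eqP; rewrite eqn_modDr => /eqP.
  by rewrite !modn_small ?digit_lt.
split; last by rewrite tP // digit_set_digit.
apply: (splits_within_agree split_S (Sa g).1 (Sa (t g)).1) => j jr Jj.
have [jN|Nj] := ltP j N; first exact: below_N.
by rewrite tP ?Nj ?(lt_trans jr) //; exact: set_digit_agree.
Qed.

Definition codeword N L J x : {ffun 'I_L -> 'I_p} :=
  [ffun i : 'I_L => if `[< J (N + (i : nat)%:Z) >] then Ordinal (digit_lt x (N + (i : nat)%:Z))
                    else Ordinal p_gt0].

Definition order_count N L J := #|[pred i : 'I_L | `[< J (N + (i : nat)%:Z) >]]|.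

Definition codewords N L J : {pred {ffun 'I_L -> 'I_p}} :=
  pffun_on (Ordinal p_gt0) [pred i : 'I_L | `[< J (N + (i : nat)%:Z) >]] 'I_p.
Arguments codewords : clear implicits.

Lemma card_codewords N L J : #|codewords N L J| = (p ^ order_count N L J)%N.
Proof. by rewrite card_pffun_on card_ord. Qed.

Lemma codeword_in N L J x : codeword N L J x \in codewords N L J.
Proof.
apply/pffun_onP; split=> //; apply/supportP => i; rewrite inE ffunE.
by move=> /negbTE->.
Qed.

Lemma codeword_eqP N L J x y : codeword N L J x = codeword N L J y <->
  forall j, N <= j < N + L%:Z -> J j -> digit x j = digit y j.
Proof.
split=> [/ffunP xy j /andP[Nj jL] Jj|xy].
  have iL : (`|(j - N)%R| < L)%N by lia.
  have := xy (Ordinal iL); rewrite !ffunE /=.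
  have -> : N + `|j - N|%N%:Z = j by lia.
  by rewrite asboolT // => -[].
apply/ffunP => i; rewrite !ffunE; case: asboolP => // Ji; apply: val_inj => /=.
by apply: xy => //; have := ltn_ord i; lia.
Qed.

Lemma codeword_surj N L J (c : {ffun 'I_L -> 'I_p}) : c \in codewords N L J ->
  exists x, codeword N L J x = c.
Proof.
move=> /pffun_onP[supp_c _].
pose d j : nat := if insub `|j - N|%N is Some i then if N <= j then c i : nat else 0%N else 0%N.
have d_valid : qp_valid p d.
  split=> [j|]; first by rewrite /d; case: insub => [i|]; [case: ifP|].
  by exists N => j jN; rewrite /d; case: insub => // i; rewrite leNgt jN.
exists (MkQP p_gt0 d_valid); apply/ffunP => i; rewrite ffunE; case: asboolP => [Ji|nJi].
  apply: val_inj; rewrite /= /d; have -> : `|(N + (i : nat)%:Z - N)%R|%N = i by lia.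
  by rewrite valK lerDl.
by apply/esym/(supportP supp_c); rewrite inE; apply/asboolP.
Qed.

Section Counting.
Variables (N : int) (L : nat) (J : set int) (S : set QP) (F : finType) (a : F -> QP).
Hypothesis split_S : splits_within J S.
Hypothesis trans_a : transversal (N + L%:Z) (S `&` zero_below N) a.

Lemma codeword_transversal_inj : injective (codeword N L J \o a).
Proof.
have [Sa _ inj_a] := trans_a.
move=> g g' /codeword_eqP gg'; apply: inj_a.
have [[Sg Ng] [Sg' Ng']] := (Sa g, Sa g').
apply: (splits_within_agree split_S) => // j jL Jj.
by have [jN|Nj] := ltP j N; [rewrite Ng ?Ng'|apply: gg' => //; rewrite Nj].
Qed.

Lemma tree_card_transversal : branches_at J S -> S `&` zero_below N !=set0 ->
  #|F| = (p ^ order_count N L J)%N.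
Proof.
move=> branch_S [s0 [Ss0 Ns0]]; have tS : tree J S by split=> //; exists s0.
rewrite -card_codewords -(card_codom codeword_transversal_inj).
apply: eq_card => c; apply/codomP/idP => [[g ->]|/codeword_surj[x <-]]; first exact: codeword_in.
have [s [Ss Ns sx]] := tree_realize (N + L%:Z) x tS Ss0 Ns0.
have [_ cover_a _] := trans_a; have [g sg] := cover_a s (conj Ss Ns).
exists g; apply/codeword_eqP => j jL Jj; rewrite -sx // sg //.
by case/andP: jL.
Qed.

Lemma card_transversal_realize x : #|F| = (p ^ order_count N L J)%N ->
  exists s, [/\ S s, zero_below N s & forall j, N <= j < N + L%:Z -> J j -> digit s j = digit x j].
Proof.
rewrite -card_codewords => cardF.
have card_codom : #|codom (codeword N L J \o a)| = #|codewords N L J|.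
  by rewrite card_codom //; exact: codeword_transversal_inj.
have codom_sub : codom (codeword N L J \o a) \subset codewords N L J.
  by apply/fintype.subsetP => _ /codomP[g ->]; exact: codeword_in.
have : codeword N L J x \in codom (codeword N L J \o a).
  by rewrite (subset_cardP card_codom codom_sub) codeword_in.
move=> /codomP[g /esym/codeword_eqP gx].
by have [/(_ g)[Sg Ng] _ _] := trans_a; exists (a g).
Qed.

End Counting.

Lemma tree_of_card J S b N0 : (forall j, J j -> j < b) -> splits_within J S ->
  (forall N L, N <= N0 -> b = N + L%:Z ->
    exists (F : finType) (a : F -> QP),
      transversal b (S `&` zero_below N) a /\ #|F| = (p ^ order_count N L J)%N) ->
  tree J S.
Proof.
move=> J_lt split_S card_S; pose M n : int := Num.min (Num.min N0 b) n.
have realize N x : N <= N0 -> N <= b -> exists s, [/\ S s, zero_below N s &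
    forall j, N <= j < b -> J j -> digit s j = digit x j].
  move=> NN0 Nb; have bE : b = N + `|b - N|%N%:Z by lia.
  have [F [a [trans_a cardF]]] := card_S _ _ NN0 bE.
  by rewrite bE in trans_a *; exact: (card_transversal_realize split_S trans_a).
split=> //; first by have [||s [Ss _ _]] := realize (Num.min N0 b) 0; [lia..|exists s].
move=> s n d Ss Jn; have [N [NM Ns _]] := zero_below2 (Num.min (Num.min N0 b) n) s s.
have [||s' [Ss' Ns' s'x]] := realize N (set_digit s n d); [lia..|].
exists s'; split=> //; last by rewrite s'x ?digit_set_digit //; have := J_lt _ Jn; lia.
apply: (splits_within_agree split_S) => // j jn Jj.
have [jN|Nj] := ltP j N; first by rewrite Ns ?Ns'.
by rewrite s'x //; [exact: set_digit_agree|have := J_lt _ Jj; lia].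
Qed.

End Transversals.

(** * Trees as isometric images *)

Section Twist.
Variables (p : nat) (p_gt0 : (0 < p)%N) (op : nat -> nat -> nat).
Hypotheses (op_lt : forall i j, (op i j < p)%N) (op00 : op 0%N 0%N = 0%N).
Local Notation QP := (QP_ p_gt0).
Implicit Types (x y : QP) (n j : int) (J : set int).

Lemma twist_valid J x y :
  qp_valid p (fun j => if `[< J j >] then digit x j else op (digit x j) (digit y j)).
Proof.
split=> [j|]; first by case: ifP => // _; exact: digit_lt.
by have [N [_ Nx Ny]] := zero_below2 0 x y; exists N => j jN; rewrite Nx // Ny // op00 if_same.
Qed.

Definition twist J x y : QP := MkQP p_gt0 (twist_valid J x y).

Lemma digit_twist_in J x y j : J j -> digit (twist J x y) j = digit x j.
Proof. by move=> Jj; rewrite /= asboolT. Qed.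

Lemma digit_twist_out J x y j : ~ J j -> digit (twist J x y) j = op (digit x j) (digit y j).
Proof. by move=> nJ; rewrite /= asboolF. Qed.

Lemma agree_twist n J x x' y y' :
  agree n x x' -> agree n y y' -> agree n (twist J x y) (twist J x' y').
Proof. by move=> xx' yy' j jn; rewrite /= xx' ?yy'. Qed.

End Twist.

Section IsometricImages.
Variables (p : nat) (p_gt0 : (0 < p)%N).
Hypothesis p_gt1 : (1 < p)%N.
Local Notation QP := (QP_ p_gt0).
Implicit Types (x y : QP) (n b : int) (J : set int) (S : set QP).

Lemma twistK (op op' : nat -> nat -> nat)
    (op_lt : forall i j, (op i j < p)%N) (op00 : op 0%N 0%N = 0%N)
    (op'_lt : forall i j, (op' i j < p)%N) (op'00 : op' 0%N 0%N = 0%N) J x y :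
  (forall i j, i < p -> j < p -> op' (op i j) j = i)%N ->
  twist op'_lt op'00 J (twist op_lt op00 J x y) y = x.
Proof.
move=> opK; apply: digit_ext => j; have [Jj|nJ] := pselect (J j).
  by rewrite !digit_twist_in.
by rewrite !digit_twist_out // opK ?digit_lt.
Qed.

Lemma isometric_image_tree J (f : QP -> QP) : isometric_bijection f -> tree J (f @` suppset J).
Proof.
move=> [_ /(isometryP p_gt1) fiso]; split; first by exists (f 0), 0.
  move=> _ _ n [x Jx <-] [y Jy <-] /fiso xy nJ.
  have : agree (n + 1) (f x) (f y) by apply/fiso; apply: agreeS => //; rewrite Jx ?Jy.
  by apply; lia.
move=> _ n d [x Jx <-] Jn; pose y e := set_digit x n e.
have Jy e : suppset J (y e).
  by move=> j nJj /=; case: eqP => [jn|_]; [rewrite jn in nJj|exact: Jx].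
pose h e : 'I_p := Ordinal (digit_lt (f (y e)) n).
have /injF_bij[g _ hg] : injective h.
  move=> e e' /(congr1 val) /= dee'; apply: val_inj => /=.
  have : agree (n + 1) (y e) (y e').
    apply/fiso; apply: agreeS => //; apply/fiso.
    by apply: agree_trans (agree_sym _) _; exact: set_digit_agree.
  by move=> /(_ n); rewrite !digit_set_digit; apply; lia.
exists (f (y (g d))); split; first by exists (y (g d)).
  by apply/fiso; exact: set_digit_agree.
by have := congr1 val (hg d).
Qed.

Lemma tree_section J S b : (forall j, J j -> j < b) -> tree J S ->
  exists g : QP -> QP, forall x, S (g x) /\ forall j, J j -> digit (g x) j = digit x j.
Proof.
move=> J_lt tS; have [[s0 Ss0] _ _] := tS.
have section_at x : exists s, S s /\ forall j, J j -> digit s j = digit x j.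
  have [N [_ Ns Nx]] := zero_below2 0 s0 x.
  have [s [Ss Ns' sx]] := tree_realize b x tS Ss0 Ns.
  exists s; split=> // j Jj; have [jN|Nj] := ltP j N; first by rewrite Ns' ?Nx.
  by apply: sx => //; have := J_lt _ Jj; lia.
by have [g gP] := choice section_at; exists g.
Qed.

Let add_lt i j : ((i + j) %% p < p)%N. Proof. by rewrite ltn_pmod. Qed.
Let sub_lt i j : ((i + (p - j)) %% p < p)%N. Proof. by rewrite ltn_pmod. Qed.
Let sub00 : ((0 + (p - 0)) %% p = 0)%N. Proof. by rewrite subn0 modnn. Qed.

Definition shift_by J (g : QP -> QP) x : QP := twist add_lt (mod0n p) J x (g x).

Lemma shift_by_isometry J (g : QP -> QP) :
  (forall n x y, (forall j, j < n -> J j -> digit x j = digit y j) -> agree n (g x) (g y)) ->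
  isometric_bijection (shift_by J g).
Proof.
move=> g_agree; pose f' x := twist sub_lt sub00 J x (g x).
have g_twist op op_lt op00 x y : g (@twist _ p_gt0 op op_lt op00 J x y) = g x.
  by apply: agree_eq => n; apply: g_agree => j _ Jj; rewrite digit_twist_in.
have twist_agree op op_lt op00 n x y : agree n x y ->
    agree n (@twist _ p_gt0 op op_lt op00 J x (g x)) (@twist _ p_gt0 op op_lt op00 J y (g y)).
  by move=> xy; apply: agree_twist => //; apply: g_agree => j jn _; exact: xy.
have fK : cancel (shift_by J g) f'.
  move=> x; rewrite /f' g_twist; apply: twistK => i j ip jp.
  by rewrite modnDml -addnA subnKC 1?ltnW // modnDr modn_small.
have f'K : cancel f' (shift_by J g).
  move=> x; rewrite /shift_by g_twist; apply: twistK => i j ip jp.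
  by rewrite modnDml -addnA subnK 1?ltnW // modnDr modn_small.
split; first by exists f'.
apply/(isometryP p_gt1) => n x y; split; last exact: twist_agree.
by move=> /(twist_agree _ sub_lt sub00); rewrite -/(f' _) -/(f' (shift_by J g y)) !fK.
Qed.

Lemma tree_isometric_image J S b : (forall j, J j -> j < b) -> tree J S ->
  exists f, isometric_bijection f /\ S = f @` suppset J.
Proof.
move=> J_lt tS; have [g gP] := tree_section J_lt tS; have [_ split_S _] := tS.
exists (shift_by J g); split.
  apply: shift_by_isometry => n x y xyJ.
  apply: (splits_within_agree split_S); [exact: (gP x).1|exact: (gP y).1|].
  by move=> j jn Jj; rewrite (gP x).2 ?(gP y).2 ?xyJ.
have shift_supp x : suppset J x -> shift_by J g x = g x.
  move=> Jx; apply: digit_ext => j; have [Jj|nJ] := pselect (J j).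
    by rewrite digit_twist_in // (gP x).2.
  by rewrite digit_twist_out // Jx // add0n modn_small ?digit_lt.
apply/seteqP; split=> [s Ss|_ [x Jx <-]]; last by rewrite shift_supp //; exact: (gP x).1.
pose s_J := twist (op := fun _ _ => 0%N) (fun _ _ => p_gt0) erefl J s s.
have Js : suppset J s_J by move=> j nJ; rewrite digit_twist_out.
exists s_J => //; rewrite shift_supp //; apply: agree_eq => n.
apply: (splits_within_agree split_S) => // [|j jn Jj]; first exact: (gP _).1.
by rewrite (gP _).2 // digit_twist_in.
Qed.

Lemma treeP J S b : (forall j, J j -> j < b) ->
  tree J S <-> exists f, isometric_bijection f /\ S = f @` suppset J.
Proof.
move=> J_lt; split=> [|[f [fiso ->]]]; first exact: tree_isometric_image J_lt.
exact: isometric_image_tree.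
Qed.

Lemma tree_suppset J : tree J (suppset J : set QP).
Proof.
have := @isometric_image_tree J id; rewrite image_id; apply.
by split=> //; exists id.
Qed.

End IsometricImages.

(** * Homogeneous sets are trees *)

Lemma finite_int_bound (T : choiceType) (F : set T) (h : T -> int) :
  finite_set F -> exists b, forall i, F i -> h i <= b.
Proof.
move=> /finite_seqP[s ->]; elim: s => [|a s [b bP]]; first by exists 0.
exists (Num.max b (h a)) => i; rewrite /= inE => /orP[/eqP->|/bP]; lia.
Qed.

Lemma card_eq_ord_enum (T : pointedType) (A : set T) (k : nat) : (A #= [set: 'I_k])%card ->
  exists f : 'I_k -> T, [/\ injective f, forall i, A (f i) &
    forall a, A a -> exists i, f i = a].
Proof.
rewrite card_eq_sym => /card_set_bijP[f [fA finj fsurj]]; exists f; split.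
- by move=> i j; apply: finj; rewrite inE.
- by move=> i; exact: fA.
- by move=> a /fsurj[i _ <-]; exists i.
Qed.

Section Homogeneous.
Variables (p : nat) (p_gt0 : (0 < p)%N).
Hypothesis p_gt1 : (1 < p)%N.
Local Notation QP := (QP_ p_gt0).
Implicit Types (x y z : QP) (N n : int) (Om : set QP).

Lemma mem_qp_ball x n : qp_ball x n x.
Proof. by rewrite qp_ballE. Qed.

Lemma qp_ball_eq n x y : agree n x y -> qp_ball x n = qp_ball y n.
Proof.
move=> xy; rewrite !qp_ballE //; apply/seteqP; split=> z /=; first by move/agree_trans; apply.
by move/agree_trans; apply; exact: agree_sym.
Qed.

Lemma qp_ball_cylinder N n x : zero_below N x -> N <= n -> cylinder N n (qp_ball x n).
Proof.
move=> Nx Nn; rewrite qp_ballE //; split=> [y xy|y z xy yz].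
  by apply: agree_zero_below Nx; exact: agree_sym (agree_le Nn xy).
exact: agree_trans (agree_sym yz) xy.
Qed.

Lemma qp_ball_tree n x : tree [set j | n <= j] (qp_ball x n).
Proof.
rewrite qp_ballE //; split=> [|y z j xy xz yz /negP|y j d xy nj]; first by exists x.
  by rewrite -ltNge => jn; rewrite xy // xz.
exists (set_digit y j d); split; last exact: digit_set_digit.
  by apply: agree_trans xy; apply/agree_sym/(agree_le nj); exact: set_digit_agree.
exact: set_digit_agree.
Qed.

Lemma qp_ball_open x n : qp_open (qp_ball x n).
Proof. by move=> y; rewrite {1}qp_ballE // => yx; exists n; rewrite (qp_ball_eq yx). Qed.

Lemma qp_compact_bounded Om : qp_compact Om -> exists N, Om `<=` zero_below N.
Proof.
move=> /(_ nat (fun i => qp_ball 0 (- i%:Z))) [||F [F_fin OmF]].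
- by move=> i; exact: qp_ball_open.
- move=> x _; have [N Nx] := zero_below_exists x; exists `|N|%N => //.
  by rewrite qp_ballE //; apply: zero_below_agree => //; apply: zero_below_le Nx; lia.
have [b bP] := @finite_int_bound nat F Posz F_fin.
exists (- b) => x /OmF[i Fi]; rewrite qp_ballE // => xi.
have b_i : - b <= - i%:Z by have := bP _ Fi; lia.
by apply: agree_zero_below (_ : zero_below _ 0) => //; apply/agree_sym/(agree_le b_i).
Qed.

Lemma qp_compact_open_cylinder Om : qp_compact Om -> qp_open Om -> exists N n, cylinder N n Om.
Proof.
move=> Om_compact Om_open; have [N OmN] := qp_compact_bounded Om_compact; exists N.
have [||F [F_fin OmF]] := Om_compact (QP * int)%type
  (fun i => [set x | qp_ball i.1 i.2 x /\ qp_ball i.1 i.2 `<=` Om]).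
- move=> i x [xi iO]; have [n nP] := qp_ball_open xi; exists n => y /nP yi.
  by split.
- move=> x Ox; have [n nO] := Om_open _ Ox; exists (x, n) => //=; split=> //.
  exact: mem_qp_ball.
have [b bP] := @finite_int_bound (QP * int)%type F snd F_fin.
exists b; split=> // x y /OmF[[a n] Fi [/= xa aO]] xy; apply: aO; move: xa.
rewrite qp_ballE //= => xa; apply: agree_trans xa.
by apply: agree_sym; apply: agree_le xy; exact: bP Fi.
Qed.

Lemma adm_ordersP Om n : adm_orders Om n <->
  exists x y, [/\ Om x, Om y, agree n x y & digit x n <> digit y n].
Proof.
split=> [[x [y [Ox [Oy /(vp_subP p_gt1)[]]]]]|[x [y [Ox Oy xy dxy]]]]; first by exists x, y.
have [xy_neq xy_vp] := iffRL (vp_subP p_gt1 x y n) (conj xy dxy).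
by exists x, y.
Qed.

Lemma Nballs_sub Om n x y : Om y -> agree n x y ->
  [set B | Nballs Om (n + 1) B /\ B `<=` qp_ball x n] (qp_ball y (n + 1)).
Proof.
move=> Oy xy; split; first by exists y; split=> //; exists y; split=> //; exact: mem_qp_ball.
rewrite (qp_ball_eq xy) !qp_ballE // => z; apply: agree_le; lia.
Qed.

Lemma Nballs_center Om n x B : [set B | Nballs Om (n + 1) B /\ B `<=` qp_ball x n] B ->
  exists y, [/\ Om y, B = qp_ball y (n + 1) & agree n x y].
Proof.
move=> [[a [-> [y [ay Oy]]]] sub]; exists y; split=> //.
  by apply/esym/qp_ball_eq; move: ay; rewrite qp_ballE.
by have := sub _ ay; rewrite qp_ballE // => /agree_sym.
Qed.

Lemma p_homogeneous_branches Om : p_homogeneous Om -> branches_at (adm_orders Om) Om.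
Proof.
move=> Om_hom s n d Os /adm_ordersP[x [y [Ox Oy xy dxy]]].
have ball_in z : Om z -> Nballs Om n (qp_ball z n).
  by move=> Oz; exists z; split=> //; exists z; split=> //; exact: mem_qp_ball.
have [one_child|p_children] := Om_hom n.
  have [f [_ _ fsurj]] := card_eq_ord_enum (one_child _ (ball_in x Ox)).
  have [i fi] := fsurj _ (Nballs_sub Ox (@agree_refl _ _ n x)).
  have [j fj] := fsurj _ (Nballs_sub Oy xy).
  have : qp_ball y (n + 1) x by rewrite -fj (ord1 j) -(ord1 i) fi; exact: mem_qp_ball.
  by rewrite qp_ballE // => /(_ n) dE; case: dxy; apply: dE; lia.
have [f [finj fA _]] := card_eq_ord_enum (p_children _ (ball_in s Os)).
have [r rP] := choice (fun i => Nballs_center (fA i)).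
pose e i : 'I_p := Ordinal (digit_lt (r i) n).
have /injF_bij[g _ eg] : injective e.
  move=> i j /(congr1 val) /= dij; apply: finj.
  have [[_ -> si] [_ -> sj]] := (rP i, rP j); apply: qp_ball_eq.
  by apply: agreeS dij; exact: agree_trans (agree_sym si) sj.
have [Or _ sr] := rP (g d).
by exists (r (g d)); split=> //; have := congr1 val (eg d).
Qed.

Lemma p_homogeneous_tree Om : p_homogeneous Om -> Om !=set0 -> tree (adm_orders Om) Om.
Proof.
move=> Om_hom Om0; split=> //; last exact: p_homogeneous_branches.
move=> x y n Ox Oy xy nI; apply: contrapT => dxy; apply: nI.
by apply/adm_ordersP; exists x, y.
Qed.

End Homogeneous.

(** * Vanishing sums of roots of unity *)

Lemma minimal_poly_irreducible (F K : fieldType) (iota : {rmorphism F -> K})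
    (f : {poly F}) (w : K) :
  (1 < size f)%N -> (forall q, root (map_poly iota q) w = (f %| q)) -> irreducible_poly f.
Proof.
move=> f_gt1 f_min; split=> // q q1 qf; rewrite /eqp qf /=.
have f0 : f != 0 by rewrite -size_poly_gt0 ltnW.
have [h fE] := dvdpP _ _ qf.
have : root (map_poly iota f) w by rewrite f_min.
rewrite {1}fE rmorphM rootM !f_min => /orP[fh|//].
have [h0 q0] : h != 0 /\ q != 0 by apply/andP; rewrite -negb_or -mulf_eq0 -fE.
have := dvdp_leq h0 fh; rewrite {1}fE size_mul // => h_size.
move: q1 q0 h0; rewrite -!size_poly_gt0 => q1 q0 h0; lia.
Qed.

Lemma irreducible_dvd_of_root (F K : fieldType) (iota : {rmorphism F -> K})
    (f g : {poly F}) (z : K) :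
  irreducible_poly f -> root (map_poly iota f) z -> root (map_poly iota g) z -> f %| g.
Proof.
move=> f_irr fz gz; have f0 := irredp_neq0 f_irr.
have gcd_gt1 : (1 < size (gcdp f g))%N.
  rewrite -(size_map_poly iota); apply: (@root_size_gt1 _ z).
    by rewrite map_poly_eq0 gcdp_eq0 (negbTE f0).
  by rewrite gcdp_map root_gcd fz.
rewrite -(eqp_dvdl _ (f_irr _ _ (dvdp_gcdl f g))) ?dvdp_gcdr //.
by rewrite neq_ltn gcd_gt1 orbT.
Qed.

Section PrimePowerRoots.
Variable p : nat.
Hypothesis p_prime : prime p.

(* The cyclotomic polynomial of order [p ^ k.+1]. *)
Definition Phi_primepow (F : nzRingType) (k : nat) : {poly F} := \sum_(j < p) 'X^(j * p ^ k).

Lemma map_Phi_primepow (F K : nzRingType) (iota : {rmorphism F -> K}) k :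
  map_poly iota (Phi_primepow F k) = Phi_primepow K k.
Proof. by rewrite /Phi_primepow rmorph_sum; apply: eq_bigr => j _; rewrite /= map_polyXn. Qed.

Lemma root_Phi_primepow (F : fieldType) k (z : F) :
  (p ^ k.+1).-primitive_root z -> root (Phi_primepow F k) z.
Proof.
move=> z_prim; set y := z ^+ (p ^ k).
have y1 : y != 1.
  rewrite -(prim_order_dvd z_prim) expnS -{2}[(p ^ k)%N]mul1n.
  by rewrite dvdn_pmul2r ?expn_gt0 ?prime_gt0 // dvdn1 neq_ltn prime_gt1 ?orbT.
have yp : y ^+ p = 1 by rewrite -exprM mulnC -expnS prim_expr_order.
rewrite /root /Phi_primepow horner_sum.
under eq_bigr do rewrite hornerXn mulnC exprM -/y.
by have := subrX1 y p; rewrite yp subrr => /esym/eqP; rewrite mulf_eq0 subr_eq0 (negbTE y1).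
Qed.

Lemma size_Phi_primepow (F : fieldType) k : size (Phi_primepow F k) = (p.-1 * p ^ k).+1.
Proof.
rewrite /Phi_primepow; case: p (prime_gt0 p_prime) => // q _ /=; rewrite big_ord_recr /=.
rewrite addrC size_polyDl ?size_polyXn // ltnS.
apply: (leq_trans (size_sum _ _ _)); apply/bigmax_leqP => j _.
by rewrite size_polyXn ltn_pmul2r ?expn_gt0.
Qed.

Lemma Phi_primepow_irreducible k : irreducible_poly (Phi_primepow rat k).
Proof.
have pk_gt0 : (0 < p ^ k.+1)%N by rewrite expn_gt0 prime_gt0.
have [w w_prim] := C_prim_root_exists pk_gt0.
have [f [fE f_monic] f_min] := minCpolyP w.
have Phi_f : f %= Phi_primepow rat k.
  rewrite -dvdp_size_eqp; last by rewrite -f_min map_Phi_primepow root_Phi_primepow.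
  rewrite size_Phi_primepow -(size_map_poly (@ratr algC)) -fE (minCpoly_cyclotomic w_prim).
  by rewrite size_cyclotomic totient_pfactor //= mulnC.
apply: (@minimal_poly_irreducible _ _ (@ratr algC) _ w) => [|q].
  rewrite size_Phi_primepow ltnS muln_gt0 expn_gt0 (prime_gt0 p_prime) andbT.
  by rewrite -subn1 subn_gt0 prime_gt1.
by rewrite f_min (eqp_dvdl _ Phi_f).
Qed.

Lemma coef_mul_Phi_primepow (Q : {poly rat}) k i : (size Q <= p ^ k)%N -> (i < p ^ k.+1)%N ->
  (Q * Phi_primepow rat k)`_i = Q`_(i %% p ^ k).
Proof.
move=> Q_size i_lt; have pk : (0 < p ^ k)%N by rewrite expn_gt0 prime_gt0.
have jp : (i %/ p ^ k < p)%N by rewrite ltn_divLR // -expnS.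
rewrite /Phi_primepow mulr_sumr coef_sum (bigD1 (Ordinal jp)) //= coefMXn ltnNge leq_trunc_div /=.
rewrite {1}(divn_eq i (p ^ k)) addKn big1 ?addr0 // => j j_neq.
rewrite coefMXn; case: ltnP => // ji; apply: nth_default; apply: leq_trans Q_size _.
have {}j_neq : (j < i %/ p ^ k)%N.
  rewrite ltn_neqAle leq_divRL // ji andbT.
  by apply: contraNneq j_neq => jE; apply/eqP/val_inj.
have := divn_eq i (p ^ k); nia.
Qed.

Lemma vanishing_sum_periodic (K : numFieldType) k (z : K) (c : nat -> nat) :
  (p ^ k.+1).-primitive_root z -> \sum_(i < p ^ k.+1) (c i)%:R * z ^+ i = 0 ->
  forall i j, (i < p ^ k.+1)%N -> (j < p ^ k.+1)%N -> i = j %[mod p ^ k] -> c i = c j.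
Proof.
move=> z_prim cz; set n := (p ^ k.+1)%N; pose P : {poly rat} := \poly_(i < n) (c i)%:R.
have Pz : root (map_poly ratr P) z.
  have -> : map_poly ratr P = \poly_(i < n) (c i)%:R :> {poly K}.
    apply/polyP => i; rewrite coef_map !coef_poly.
    by case: ifP => _; [exact: ratr_nat|exact: rmorph0].
  by rewrite /root horner_poly cz.
have /dvdpP[Q PQ] : Phi_primepow rat k %| P.
  apply: irreducible_dvd_of_root (Phi_primepow_irreducible k) _ Pz.
  by rewrite map_Phi_primepow root_Phi_primepow.
have Q_size : (size Q <= p ^ k)%N.
  have [->|Q0] := eqVneq Q 0; first by rewrite size_poly0.
  have : (size P <= n)%N by exact: size_poly.
  rewrite PQ size_mul ?(irredp_neq0 (Phi_primepow_irreducible k)) //.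
  rewrite size_Phi_primepow /n expnS addnS /=.
  have -> : (p * p ^ k = p ^ k + p.-1 * p ^ k)%N by rewrite -mulSn prednK ?prime_gt0.
  by rewrite leq_add2r.
have cE i : (i < n)%N -> (c i)%:R = Q`_(i %% p ^ k).
  by move=> i_lt; rewrite -coef_mul_Phi_primepow // -PQ coef_poly i_lt.
by move=> i j i_lt j_lt ij; have := cE i i_lt; rewrite ij -cE // => /eqP; rewrite eqr_nat => /eqP.
Qed.

Lemma vanishing_sum_split (K : numFieldType) k (z : K) (F : finType) (w : F -> nat) (g0 : F) :
  (p ^ k.+1).-primitive_root z -> \sum_g z ^+ w g = 0 ->
  exists g g', w g = w g' %[mod p ^ k] /\ w g <> w g' %[mod p ^ k.+1].
Proof.
move=> z_prim wz; set n := (p ^ k.+1)%N.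
have n_gt0 : (0 < n)%N by rewrite expn_gt0 prime_gt0.
pose c (i : nat) := #|[pred g | (w g %% n)%N == i]|.
have cz : \sum_(i < n) (c i)%:R * z ^+ i = 0.
  rewrite -[RHS]wz [RHS](partition_big (fun g => Ordinal (ltn_pmod (w g) n_gt0)) xpredT) //=.
  apply: eq_bigr => i _; rewrite /c -sum1_card natr_sum mulr_suml.
  apply: eq_big => [g|g /eqP gi]; first by rewrite inE.
  by rewrite mul1r -[RHS](prim_expr_mod z_prim) gi.
pose i := (w g0 %% n)%N; pose j := ((i + p ^ k) %% n)%N.
have i_lt : (i < n)%N by rewrite ltn_pmod.
have pk_dvd : (p ^ k %| n)%N by rewrite dvdn_exp2l.
have ij : i = j %[mod p ^ k] by rewrite /j modn_dvdm // modnDr.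
have : (0 < c j)%N.
  rewrite -(vanishing_sum_periodic z_prim cz i_lt _ ij) ?ltn_pmod //.
  by apply/card_gt0P; exists g0; rewrite inE.
move=> /card_gt0P[g]; rewrite inE => /eqP gj; exists g0, g; split.
  by rewrite -(modn_dvdm (w g0) pk_dvd) -(modn_dvdm (w g) pk_dvd) gj -/i.
rewrite -/n gj -/i => ijE.
have : (i + p ^ k = i + 0 %[mod n])%N by rewrite addn0 -/j -ijE modn_small.
move/eqP; rewrite eqn_modDl mod0n modn_small ?expn_eq0 ?ltn_exp2l ?prime_gt1 //.
by rewrite eqn0Ngt prime_gt0.
Qed.

End PrimePowerRoots.

(** * Characters *)

Section UnitCircle.
Variable R : realType.
Implicit Types (s t : R) (q : rat).

Definition cis t : R[i] := Complex (cos t) (sin t).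

Lemma cis0 : cis 0 = 1.
Proof. by rewrite /cis cos0 sin0. Qed.

Lemma cisD s t : cis (s + t) = cis s * cis t.
Proof. by rewrite /cis cosD sinD; apply/eqP; rewrite eq_complex /= eqxx /= addrC. Qed.

Lemma cisN t : cis (- t) = (cis t)^*%C.
Proof. by rewrite /cis cosN sinN. Qed.

Lemma cis_mul_conj t : cis t * (cis t)^*%C = 1.
Proof. by rewrite -cisN -cisD subrr cis0. Qed.

Definition e2pi q : R[i] := cis (2 * pi * ratr q).

Lemma e2pi0 : e2pi 0 = 1.
Proof. by rewrite /e2pi rmorph0 mulr0 cis0. Qed.

Lemma e2piD q q' : e2pi (q + q') = e2pi q * e2pi q'.
Proof. by rewrite /e2pi rmorphD mulrDr cisD. Qed.

Lemma e2pi_exp q (n : nat) : e2pi q ^+ n = e2pi (q * n%:R).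
Proof.
elim: n => [|n IH]; first by rewrite mulr0 e2pi0 expr0.
by rewrite exprSr IH -e2piD -natr1 mulrDr mulr1.
Qed.

Lemma e2pi_int q : q \is a Num.int -> e2pi q = 1.
Proof.
have e2pi_nat (n : nat) : e2pi n%:R = 1.
  rewrite -[n%:R]mul1r -e2pi_exp; suff -> : e2pi 1 = 1 by rewrite expr1n.
  by rewrite /e2pi rmorph1 mulr1 mulr_natl /cis cos2pi sin2pi.
move=> /intrP[[n|n] ->]; first exact: e2pi_nat.
by rewrite NegzE mulrNz -[LHS]mulr1 -(e2pi_nat n.+1) -e2piD addNr e2pi0.
Qed.

Lemma e2pi_eq1 q : e2pi q = 1 -> q \is a Num.int.
Proof.
move=> q1; pose f := q - (Num.floor q)%:~R.
have f1 : e2pi f = 1 by rewrite e2piD q1 mul1r e2pi_int ?rpredN ?intr_int.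
have f_ge0 : 0 <= f by rewrite subr_ge0 ge_floor.
have f_lt1 : f < 1 by have := lt_succ_floor q; rewrite intrD ltrBlDl.
have [f0|f0] := eqVneq f 0; first by rewrite -[q](subrK (Num.floor q)%:~R) -/f f0 add0r intr_int.
have {f0 f_ge0}f_gt0 : 0 < f by rewrite lt_neqAle eq_sym f0.
exfalso; move: f1 => [+ _]; rewrite -mulrA mulr_natl cos_mulr2n; set t := pi * _ => cos2t.
have : 0 < sin t.
  rewrite sin_gt0_pi // mulr_gt0 ?pi_gt0 ?ltr0q //=.
  by rewrite gtr_pMr ?pi_gt0 // -(rmorph1 (@ratr R)) ltr_rat.
have := sin2cos2 t; have -> : cos t ^+ 2 = 1 by lra.
by rewrite subrr => /eqP; rewrite expf_eq0 /= => /eqP->; rewrite ltxx.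
Qed.

Lemma e2pi_primitive (p d k : nat) : prime p -> ~~ (p %| d)%N ->
  (p ^ k.+1).-primitive_root (e2pi (d%:R / (p ^ k.+1)%:R)).
Proof.
move=> p_prime pd; set n := (p ^ k.+1)%N.
have n_gt0 : (0 < n)%N by rewrite expn_gt0 prime_gt0.
have n0 : (n%:R : rat) != 0 by rewrite pnatr_eq0 -lt0n.
have zn : e2pi (d%:R / n%:R) ^+ n = 1 by rewrite e2pi_exp divfK // e2pi_int ?rpred_nat.
have [m m_prim mn] := prim_order_exists n_gt0 zn.
suff nm : (n %| m)%N.
  by have {1}<- : m = n by apply/eqP; rewrite eqn_dvd nm mn.
have := prim_expr_order m_prim; rewrite e2pi_exp => /e2pi_eq1/intrP[c].
move=> /(congr1 (fun x => x * n%:R)); rewrite mulrAC divfK // -natrM => dmE.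
have : (n%:Z %| (d * m)%N%:Z)%Z.
  by apply/dvdzP; exists c; apply/eqP; rewrite -(eqr_int rat) -pmulrn dmE rmorphM.
by rewrite dvdzE /= Gauss_dvdr // /n coprime_pexpl // prime_coprime.
Qed.

End UnitCircle.

Section Characters.
Variables (R : realType) (p : nat) (p_gt0 : (0 < p)%N).
Hypothesis p_gt1 : (1 < p)%N.
Local Notation QP := (QP_ p_gt0).
Local Notation e2pi := (e2pi R).
Implicit Types (l x y : QP) (N n k : int).

Let p_neq0 : (p%:R : rat) != 0.
Proof. by rewrite pnatr_eq0 -lt0n. Qed.

Lemma eqmod_e2pi q r : eqmod p 0 q r -> e2pi q = e2pi r.
Proof.
by rewrite /eqmod expr0z divr1 => qr; rewrite -[q](subrK r) e2piD e2pi_int ?mul1r.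
Qed.

Definition chi l x : R[i] := cis (theta R l x).

Lemma chiE N M l x : zero_below N l -> zero_below M x ->
  chi l x = e2pi (trunc (- M) l * trunc (- N) x).
Proof. by move=> Nl Mx; apply: eqmod_e2pi; exact: frac_mul. Qed.

Lemma chiC l x : chi l x = chi x l.
Proof.
have [N [_ Nl Nx]] := zero_below2 0 l x.
by rewrite !(chiE (N := N) (M := N)) // mulrC.
Qed.

Lemma chiDr l x y : chi l (x + y) = chi l x * chi l y.
Proof.
have [N [_ Nl _]] := zero_below2 0 l l; have [M [_ Mx My]] := zero_below2 0 x y.
rewrite !(chiE Nl (M := M)) //; last exact: zero_belowD.
rewrite -e2piD -mulrDr; apply: eqmod_e2pi; have -> : 0 = - N + N by lia.
by apply: eqmodM => //; [exact: truncD|exact: trunc_mod0].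
Qed.

Lemma chiDl l l' x : chi (l + l') x = chi l x * chi l' x.
Proof. by rewrite chiC chiDr !(chiC x). Qed.

Lemma chi_mul_conj l x : chi l x * (chi l x)^*%C = 1.
Proof. exact: cis_mul_conj. Qed.

Lemma chiBl l l' x : chi (l - l') x = chi l x * (chi l' x)^*%C.
Proof. by rewrite -[in RHS](subrK l' l) [in RHS]chiDl -mulrA chi_mul_conj mulr1. Qed.

Lemma chiBr l x y : chi l (x - y) = chi l x * (chi l y)^*%C.
Proof. by rewrite chiC chiBl !(chiC l). Qed.

Lemma chi0r l : chi l 0 = 1.
Proof. by rewrite -(subrr l) chiBr chi_mul_conj. Qed.

Lemma chi0l x : chi 0 x = 1.
Proof. by rewrite chiC chi0r. Qed.

Lemma chiNl l x : chi (- l) x = (chi l x)^*%C.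
Proof. by rewrite -sub0r chiBl chi0l mul1r. Qed.

Lemma chiNr l x : chi l (- x) = chi (- l) x.
Proof. by rewrite chiC !chiNl chiC. Qed.

Lemma chi_agree n l x y : zero_below (- n) l -> agree n x y -> chi l x = chi l y.
Proof.
move=> nl xy; have [N [_ Nx Ny]] := zero_below2 0 x y.
by rewrite !(chiE nl (M := N)) // opprK (iffLR (agree_trunc _ _ _) xy).
Qed.

Lemma chi_eq1 n l x : zero_below (- n) l -> zero_below n x -> chi l x = 1.
Proof. by move=> nl nx; rewrite (chi_agree nl (y := 0)) ?chi0r //; exact: zero_below_agree. Qed.

Lemma chi_low k l x : zero_below k l -> zero_below (- k - 1) x ->
  chi l x = e2pi ((digit l k)%:R * (digit x (- k - 1))%:R / p%:R).
Proof.
move=> kl kx; rewrite (chiE kl kx); have -> : - (- k - 1) = k + 1 by lia.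
have -> : trunc (- k) x = trunc (- k - 1 + 1) x by rewrite subrK.
rewrite !truncS !trunc_eq0 // !add0r mulrACA -expfzDr //.
by have -> : k + (- k - 1) = - 1 by lia.
Qed.

Lemma chi_agree_shift k l x y (c : nat) : zero_below k l -> agree (- k - 1) x y ->
  (digit y (- k - 1) = digit x (- k - 1) + c %[mod p])%N ->
  chi l y = chi l x * e2pi ((digit l k)%:R * c%:R / p%:R).
Proof.
move=> kl /agree_sym yx /(modn_eqmod p_gt0) yxc.
rewrite -{1}[y](subrK x) addrC chiDr; congr (_ * _).
rewrite (chi_low kl); last exact/agreeP.
apply: eqmod_e2pi; rewrite /eqmod expr0z divr1 -mulrBl -mulrBr -mulrA.
apply: rpredM; first by rewrite rpred_nat.
have := eqmod_trans (digitB yx) (eqmodD yxc (eqmod_refl _ _ _)).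
by rewrite natrD addrAC subrr add0r /eqmod expr1z.
Qed.

Lemma e2pi_digit_neq1 k l : digit l k <> 0%N -> e2pi ((digit l k)%:R / p%:R) != 1.
Proof.
move=> /eqP lk0; apply/eqP => /e2pi_eq1/norm_intr_ge1.
rewrite mulf_neq0 ?invr_neq0 // ?pnatr_eq0 // => /(_ isT).
by rewrite normf_div !normr_nat ler_pdivlMr ?ltr0n // mul1r ler_nat leqNgt digit_lt.
Qed.

(* Incrementing the digit of the summation variable that the leading digit of [l]
   pairs with multiplies the sum by a nontrivial root of unity. *)
Lemma tree_sum_chi N n k J (S : set QP) (F : finType) (a : F -> QP) l :
  splits_within J S -> branches_at J S -> transversal n (S `&` zero_below N) a ->
  zero_below k l -> digit l k <> 0%N -> J (- k - 1) -> N <= - k - 1 < n ->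
  \sum_g chi l (a g) = 0.
Proof.
move=> split_S branch_S trans_a kl lk0 Jk kn.
have [t t_inj tP] := transversal_shift split_S branch_S trans_a Jk kn.
set s := \sum_g _; have s_shift : s = s * e2pi ((digit l k)%:R / p%:R).
  rewrite {1}/s (reindex_inj t_inj) /= mulr_suml; apply: eq_bigr => g _.
  have [ag tg] := tP g; rewrite (chi_agree_shift (c := 1) kl ag) ?mulr1 //.
  by rewrite tg modn_mod.
apply: contraTeq (e2pi_digit_neq1 lk0) => s0; rewrite negbK; apply/eqP/(mulfI s0).
by rewrite -s_shift mulr1.
Qed.

Lemma sum_chi_eq0_split M k (F : finType) (a : F -> QP) (g0 : F) l : prime p ->
  (forall g, zero_below M (a g)) -> zero_below k l -> digit l k <> 0%N ->
  \sum_g chi l (a g) = 0 ->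
  exists g g', agree (- k - 1) (a g) (a g') /\ digit (a g) (- k - 1) <> digit (a g') (- k - 1).
Proof.
move=> p_prime Ma kl lk0; have [kM|Mk] := ltP (- k - 1) M.
  rewrite (eq_bigr (fun=> 1)) => [|g _].
    rewrite sumr_const => /eqP; rewrite pnatr_eq0 -leqn0 leqNgt; case/negP.
    by apply/card_gt0P; exists g0.
  by apply: (chi_eq1 (n := - k)); [rewrite opprK|apply: zero_below_le (Ma g); lia].
pose r := `|(- k - 1 - M)%R|%N; pose z := e2pi ((block k r.+1 l)%:R / (p ^ r.+1)%:R).
have kE : - k - 1 = M + r%:Z by lia.
have chi_block g : chi l (a g) = z ^+ block M r.+1 (a g).
  rewrite (chiE kl (Ma g)) e2pi_exp; congr e2pi.
  have -> : - M = k + r.+1%:Z by lia.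
  have -> : - k = M + r.+1%:Z by lia.
  rewrite !truncE // mulrACA -expfzDr // mulrAC -mulrA mulrC -mulrA natrX.
  by have -> : k + M = - r.+1%:Z by lia.
have z_prim : (p ^ r.+1).-primitive_root z.
  apply: e2pi_primitive => //; rewrite /dvdn -[X in (_ %% X)%N]expn1 block_modn //.
  by rewrite blockS block0 expn0 addr0 muln1; apply/eqP.
under eq_bigr do rewrite chi_block.
move=> /(vanishing_sum_split p_prime g0 z_prim)[g [g' []]].
rewrite !block_modn // => block_eq block_neq; exists g, g'; rewrite kE.
have agree_r : agree (M + r%:Z) (a g) (a g') by apply: block_inj.
split=> // digit_eq; apply: block_neq; apply: agree_block.
have -> : M + r.+1%:Z = M + r%:Z + 1 by lia.
exact: agreeS.
Qed.

End Characters.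

(** * Tijdeman's lemma *)

Section ModXnSub1.
Variables (K : fieldType) (n : nat).
Hypothesis n_gt0 : (0 < n)%N.
Implicit Types (A B : finType) (i k : nat).

Local Notation Xn1 := ('X^n - 1 : {poly K}).
Local Notation geom := (\sum_(i < n) 'X^i : {poly K}).

Definition genpoly A (a : A -> nat) : {poly K} := \sum_x 'X^(a x).

Lemma size_Xn1 : size Xn1 = n.+1.
Proof. by rewrite -[1]/(1%:P) size_XnsubC. Qed.

Lemma modp_sum (I : finType) (f g : I -> {poly K}) :
  (forall x, f x %% Xn1 = g x %% Xn1) -> (\sum_x f x) %% Xn1 = (\sum_x g x) %% Xn1.
Proof. by move=> fg; elim/big_rec2: _ => // i u v _ uv; rewrite !modpD fg uv. Qed.

Lemma modp_Xn i : 'X^i %% Xn1 = 'X^(i %% n) %% Xn1.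
Proof.
rewrite {1}(divn_eq i n); elim: (i %/ n)%N => [|k IH]; first by rewrite mul0n.
have Xn_mod : 'X^n %% Xn1 = 1 %% Xn1 by rewrite -{1}['X^n](subrK 1) modpD modpp add0r.
by rewrite mulSn -addnA exprD mulrC -modp_mul Xn_mod modp_mul mulr1.
Qed.

Lemma modp_Xn_geom i : ('X^i * geom) %% Xn1 = geom %% Xn1.
Proof.
have X_geom : 'X * geom = geom + Xn1.
  by have := subrX1 ('X : {poly K}) n; rewrite mulrBl mul1r => ->; rewrite addrC subrK.
elim: i => [|i IH]; first by rewrite expr0 mul1r.
by rewrite exprSr -mulrA -modp_mul X_geom modpD modpp addr0 modp_mul.
Qed.

Lemma modp_genpolyX_geom A (a : A -> nat) k :
  (genpoly a ^+ k * geom) %% Xn1 = ((#|A| ^ k)%:R * geom) %% Xn1.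
Proof.
have genpoly_geom : (genpoly a * geom) %% Xn1 = (#|A|%:R * geom) %% Xn1.
  rewrite /genpoly mulr_suml (modp_sum (g := fun=> geom)) => [|x]; last exact: modp_Xn_geom.
  by rewrite sumr_const mulr_natl.
elim: k => [|k IH]; first by rewrite expr0 expn0.
rewrite exprSr -mulrA -modp_mul genpoly_geom modp_mul mulrCA -[LHS]modp_mul IH modp_mul.
by rewrite expnS natrM mulrA.
Qed.

Lemma modp_genpolyM A B (a : A -> nat) (b : B -> nat) :
  (genpoly a * genpoly b) %% Xn1 = genpoly (fun c : A * B => (a c.1 + b c.2) %% n)%N %% Xn1.
Proof.
rewrite /genpoly big_distrlr /= pair_bigA /=; apply: modp_sum => c.
by rewrite -exprD modp_Xn.
Qed.

Lemma genpoly_bij A (a : A -> 'I_n) : bijective a -> genpoly a = geom.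
Proof. by move=> a_bij; rewrite /genpoly [RHS](reindex a) //; exact: onW_bij. Qed.

Lemma genpoly_frobenius A (a : A -> nat) q : q \in [pchar K] ->
  genpoly (fun x => q * a x)%N = genpoly a ^+ q.
Proof.
rewrite -pchar_poly => qK; rewrite -(pFrobenius_autE qK) /genpoly rmorph_sum.
by apply: eq_bigr => x _; rewrite /= pFrobenius_autE -exprM mulnC.
Qed.

Lemma genpoly_small_eq A (a : A -> 'I_n) c :
  genpoly a %% Xn1 = (c%:R * geom) %% Xn1 -> genpoly a = c%:R * geom.
Proof.
have size_le (I : finType) (u : I -> 'I_n) : (size (genpoly u) <= n)%N.
  apply: leq_trans (size_sum _ _ _) _; apply/bigmax_leqP => x _; rewrite size_polyXn.
  exact: ltn_ord.
rewrite !modp_small // size_Xn1 ltnS //.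
rewrite mulr_natl -scaler_nat; apply: leq_trans (size_scale_leq _ _) _.
exact: (size_le _ (@id 'I_n)).
Qed.

Lemma genpoly_eq_surj A (a : A -> 'I_n) c : c%:R != 0 :> K -> genpoly a = c%:R * geom ->
  forall z, exists x, a x = z.
Proof.
move=> c0 aE z; apply: contrapT => nz; case/eqP: c0.
have geomE : geom = \poly_(i < n) 1 by rewrite poly_def; apply: eq_bigr => i _; rewrite scale1r.
have := congr1 (fun P : {poly K} => P`_z) aE.
rewrite mulr_natl coefMn geomE coef_poly ltn_ord => <-.
rewrite coef_sum big1 // => x _; rewrite coefXn; case: eqP => // zx.
by case: nz; exists x; apply: val_inj.
Qed.

End ModXnSub1.

Section Tijdeman.
Local Open Scope nat_scope.
Variables (n : nat) (A B : finType).
Hypotheses (n_gt0 : 0 < n) (cardAB : #|A| * #|B| = n).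

Definition direct_mod (a : A -> nat) (b : B -> nat) := forall x x' y y',
  a x + b y = a x' + b y' %[mod n] -> x = x' /\ y = y'.

Definition sum_mod (a : A -> nat) (b : B -> nat) (c : A * B) : 'I_n :=
  Ordinal (ltn_pmod (a c.1 + b c.2) n_gt0).

Let card_pair : #|{: A * B}| = #|'I_n|.
Proof. by rewrite card_prod card_ord. Qed.

Lemma direct_mod_inj a b : direct_mod a b -> injective (sum_mod a b).
Proof. by move=> ab [x y] [x' y'] /(congr1 val) /= /ab[-> ->]. Qed.

Lemma direct_mod_bij a b : direct_mod a b -> bijective (sum_mod a b).
Proof. by move=> /direct_mod_inj ab; apply: inj_card_bij ab _; rewrite card_pair. Qed.

Lemma surj_direct_mod a b : (forall z, exists c, sum_mod a b c = z) -> direct_mod a b.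
Proof.
move=> surj; have [g gK] := choice surj.
have [h gh hg] := inj_card_bij (can_inj gK) (eq_leq card_pair).
move=> x x' y y' e; have : sum_mod a b (x, y) = sum_mod a b (x', y') by exact: val_inj.
by rewrite -(hg (x, y)) -(hg (x', y')) !gK => /(congr1 g); rewrite !hg => -[].
Qed.

(* Over [F_q], [A(X) B(X) = 1 + ... + X^(n-1)] modulo [X^n - 1] gives
   [A(X^q) B(X) = A(X)^q B(X) = #|A|^(q-1) (1 + ... + X^(n-1))]. *)
Lemma direct_mod_prime a b q : prime q -> coprime q n -> direct_mod a b ->
  direct_mod (fun x => q * a x) b.
Proof.
move=> q_prime qn ab; apply: surj_direct_mod; pose K := 'F_q.
have qK : q \in [pchar K] by exact: pchar_Fp.
apply: (@genpoly_eq_surj K _ _ _ (#|A| ^ q.-1)).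
  rewrite -(dvdn_pcharf qK) Euclid_dvdX // negb_and; apply/orP; left.
  apply: contraL qn => qA; rewrite prime_coprime // negbK -cardAB.
  exact: dvdn_mulr.
apply: (genpoly_small_eq n_gt0); rewrite -(modp_genpolyX_geom _ _ a) -(modp_genpolyM K n _ b).
have aqE : (genpoly K a ^+ q = genpoly K a ^+ q.-1 * genpoly K a)%R.
  by rewrite -exprSr prednK ?prime_gt0.
rewrite genpoly_frobenius // aqE -mulrA -[LHS]modp_mul.
by rewrite modp_genpolyM [X in (_ * (X %% _))%R](genpoly_bij K (direct_mod_bij ab)) modp_mul.
Qed.

Lemma direct_mod_coprime a b k : 0 < k -> coprime k n -> direct_mod a b ->
  direct_mod (fun x => k * a x) b.
Proof.
elim/ltn_ind: k a => k IH a k_gt0 kn ab.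
have [k1|k1] := leqP k 1.
  have -> : k = 1 by lia.
  by move=> x x' y y'; rewrite !mul1n; exact: ab.
have q_prime := pdiv_prime k1; set q := pdiv k in q_prime.
have qk : q %| k by exact: pdiv_dvd.
have kE := divnK qk.
have k'_gt0 : 0 < k %/ q by rewrite divn_gt0 ?prime_gt0 // dvdn_leq.
have k'n : coprime (k %/ q) n by apply: coprime_dvdl kn; rewrite -{2}kE dvdn_mulr.
have qn : coprime q n by apply: coprime_dvdl kn.
have k'k : k %/ q < k by rewrite ltn_Pdiv ?prime_gt1.
move=> x x' y y' e; apply: (IH _ k'k _ k'_gt0 k'n (direct_mod_prime q_prime qn ab)).
by rewrite !mulnA kE.
Qed.

End Tijdeman.

(** * Integration *)

Section ComplexParts.
Variable R : realType.
Implicit Types x y : R[i].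

Lemma ReD x y : complex.Re (x + y) = complex.Re x + complex.Re y.
Proof. by case: x y => ? ? []. Qed.

Lemma ImD x y : complex.Im (x + y) = complex.Im x + complex.Im y.
Proof. by case: x y => ? ? []. Qed.

Lemma ReM x y : complex.Re (x * y) = complex.Re x * complex.Re y - complex.Im x * complex.Im y.
Proof. by case: x y => ? ? []. Qed.

Lemma ImM x y : complex.Im (x * y) = complex.Re x * complex.Im y + complex.Im x * complex.Re y.
Proof. by case: x y => ? ? []. Qed.

Lemma Re_sum (F : finType) (f : F -> R[i]) : complex.Re (\sum_g f g) = \sum_g complex.Re (f g).
Proof. by apply: (big_morph (@complex.Re R)) => // x y; exact: ReD. Qed.

Lemma Im_sum (F : finType) (f : F -> R[i]) : complex.Im (\sum_g f g) = \sum_g complex.Im (f g).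
Proof. by apply: (big_morph (@complex.Im R)) => // x y; exact: ImD. Qed.

End ComplexParts.

Section ComplexIntegral.
Context d (T : measurableType d) (R : realType) (mu : {measure set T -> \bar R}) (D : set T).
Hypothesis mD : measurable D.
Implicit Types (f g : T -> R[i]) (c : R[i]).

Definition cintegrable f :=
  mu.-integrable D (EFin \o (fun x => complex.Re (f x))) /\
  mu.-integrable D (EFin \o (fun x => complex.Im (f x))).

Definition cintegral f : R[i] :=
  Complex (\int[mu]_(x in D) complex.Re (f x)) (\int[mu]_(x in D) complex.Im (f x)).

Lemma eq_cintegral f g : {in D, f =1 g} -> cintegral f = cintegral g.
Proof. by move=> fg; congr Complex; apply: eq_Rintegral => x Dx; rewrite fg. Qed.

Lemma cintegralP f c : cintegrable f ->
  ((\int[mu]_(x in D) (complex.Re (f x))%:E)%E = (complex.Re c)%:E /\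
   (\int[mu]_(x in D) (complex.Im (f x))%:E)%E = (complex.Im c)%:E) <-> cintegral f = c.
Proof.
move=> [fRe fIm]; split=> [[cRe cIm]|<-].
  by case: c cRe cIm => a b /= aE bE; rewrite /cintegral /Rintegral aE bE.
by split; rewrite /= fineK //; exact: integrable_fin_num.
Qed.

Lemma cintegrableD f g : cintegrable f -> cintegrable g -> cintegrable (fun x => f x + g x).
Proof.
move=> [fRe fIm] [gRe gIm].
split.
  by apply: eq_integrable (integrableD mD fRe gRe) => // x _ /=; rewrite ReD EFinD.
by apply: eq_integrable (integrableD mD fIm gIm) => // x _ /=; rewrite ImD EFinD.
Qed.

Lemma cintegralD f g : cintegrable f -> cintegrable g ->
  cintegral (fun x => f x + g x) = cintegral f + cintegral g.
Proof.
move=> [fRe fIm] [gRe gIm]; apply/eqP; rewrite eq_complex /= -!RintegralD //.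
by apply/andP; split; apply/eqP/eq_Rintegral => x _; rewrite ?ReD ?ImD.
Qed.

Lemma cintegrableZ c f : cintegrable f -> cintegrable (fun x => c * f x).
Proof.
move=> [fRe fIm]; have intZ k h := @integrableZl _ _ _ mu _ mD k h.
set a := complex.Re c; set b := complex.Im c; split.
  apply: eq_integrable (integrableB mD (intZ a _ fRe) (intZ b _ fIm)) => //.
  by move=> x _ /=; rewrite ReM EFinB !EFinM.
apply: eq_integrable (integrableD mD (intZ a _ fIm) (intZ b _ fRe)) => //.
by move=> x _ /=; rewrite ImM EFinD !EFinM.
Qed.

Lemma cintegralZ c f : cintegrable f -> cintegral (fun x => c * f x) = c * cintegral f.
Proof.
move=> [fRe fIm]; have intZ k h (fh : mu.-integrable D (EFin \o h)) :
    mu.-integrable D (EFin \o (fun x => k * h x)).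
  by apply: eq_integrable (integrableZl mD k fh) => // x _ /=; rewrite EFinM.
apply/eqP; rewrite eq_complex ReM ImM /= -!RintegralZl // -RintegralB -?RintegralD //;
  try exact: intZ.
by apply/andP; split; apply/eqP/eq_Rintegral => x _; rewrite ?ReM ?ImM.
Qed.

Lemma cintegrable0 : cintegrable (fun=> 0).
Proof. by split; exact: integrable0. Qed.

Lemma cintegral0 : cintegral (fun=> 0) = 0.
Proof.
by rewrite -[RHS](mul0r (cintegral (fun=> 0))) -cintegralZ;
  [apply: eq_cintegral => x _; rewrite mul0r|exact: cintegrable0].
Qed.

Lemma cintegrable_sum (I : Type) (s : seq I) (f : I -> T -> R[i]) :
  (forall i, cintegrable (f i)) -> cintegrable (fun x => \sum_(i <- s) f i x).
Proof.
move=> f_int; elim: s => [|i s IH].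
  by under eq_fun do rewrite big_nil; exact: cintegrable0.
by under eq_fun do rewrite big_cons; exact: cintegrableD.
Qed.

Lemma cintegral_sum (I : Type) (s : seq I) (f : I -> T -> R[i]) :
  (forall i, cintegrable (f i)) ->
  cintegral (fun x => \sum_(i <- s) f i x) = \sum_(i <- s) cintegral (f i).
Proof.
move=> f_int; elim: s => [|i s IH].
  by rewrite big_nil -[RHS]cintegral0; apply: eq_cintegral => x _; rewrite big_nil.
rewrite big_cons -IH -cintegralD //; last exact: cintegrable_sum.
by apply: eq_cintegral => x _; rewrite big_cons.
Qed.

Lemma cintegrableM_bounded f g : cintegrable f ->
  measurable_fun D (fun x => complex.Re (g x)) -> [bounded complex.Re (g x) | x in D] ->
  measurable_fun D (fun x => complex.Im (g x)) -> [bounded complex.Im (g x) | x in D] ->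
  cintegrable (fun x => f x * g x).
Proof.
move=> [fRe fIm] mRe bRe mIm bIm.
have ReRe := integrableMl mD fRe mRe bRe; have ImIm := integrableMl mD fIm mIm bIm.
have ReIm := integrableMl mD fRe mIm bIm; have ImRe := integrableMl mD fIm mRe bRe.
split; first apply: eq_integrable (integrableB mD ReRe ImIm) => //.
  by move=> x _ /=; rewrite ReM EFinB !EFinM.
apply: eq_integrable (integrableD mD ReIm ImRe) => //.
by move=> x _ /=; rewrite ImM EFinD !EFinM.
Qed.

Lemma square_integrable_integrable (u : T -> R) : (mu D < +oo)%E -> measurable_fun D u ->
  mu.-integrable D (fun x => (u x ^+ 2)%:E) -> mu.-integrable D (EFin \o u).
Proof.
move=> D_fin mu_u u2_int; have one_int : mu.-integrable D (EFin \o (fun=> 1 : R)).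
  by apply: measurable_bounded_integrable => //; exact: bounded_cst.
apply: (le_integrable mD _ _ (integrableD mD one_int u2_int)); first exact/measurable_EFinP.
move=> x _ /=; rewrite lee_fin [leRHS]ger0_norm ?addr_ge0 ?sqr_ge0 // ler_norml.
by apply/andP; split; nra.
Qed.

Definition square_cintegrable f :=
  [/\ measurable_fun D (fun x => complex.Re (f x)), measurable_fun D (fun x => complex.Im (f x)),
      mu.-integrable D (fun x => (complex.Re (f x) ^+ 2)%:E) &
      mu.-integrable D (fun x => (complex.Im (f x) ^+ 2)%:E)].

Lemma square_cintegrable_cintegrable f : (mu D < +oo)%E -> square_cintegrable f -> cintegrable f.
Proof. by move=> D_fin [mRe mIm Re2 Im2]; split; exact: square_integrable_integrable. Qed.

Lemma ae_eq0_of_setI_closed (G : set (set T)) (f : T -> \bar R) :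
  @measurable _ T = <<s G>> -> setI_closed G -> mu.-integrable D f ->
  (\int[mu]_(x in D) f x = 0)%E ->
  (forall B, G B -> \int[mu]_(x in D `&` B) f x = 0)%E ->
  {ae mu, forall x, D x -> f x = 0%E}.
Proof.
move=> GE GI f_int D0 G0.
have f0 (S : set T) : measurable S -> (\int[mu]_(x in D `&` S) f x = 0)%E.
  rewrite {1}GE; move: S.
  apply: (@dynkin_induction _ T G (fun S => \int[mu]_(x in D `&` S) f x = 0)%E GE GI) => //.
  - by rewrite setIT.
  - move=> S mS S0; move: D0; rewrite -{1}(setIT D) -(setUv S) setIUr integral_setU.
    + by rewrite S0 add0e.
    + exact: measurableI.
    + by apply: measurableI => //; exact: measurableC.
    + by rewrite -setIUr setUv setIT; exact: measurable_int f_int.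
    + by apply/disj_setPS => x [[_ Sx] [_ nSx]].
  - move=> F mF tF F0; rewrite setI_bigcupr integral_bigcup.
    + by apply: eseries0 => i _ _; exact: F0.
    + exact: trivIset_setIl.
    + by move=> i; exact: measurableI.
    + apply: integrableS f_int => //; last by move=> x [i _ []].
      by apply: bigcupT_measurable => i; exact: measurableI.
have f_eq0 (E : set T) : E `<=` D -> measurable E ->
    (\int[mu]_(x in E) f x = \int[mu]_(x in E) cst 0 x)%E.
  by move=> ED mE; rewrite integral0 -(setIidr ED); exact: f0.
have := integral_ae_eq mD (g := cst 0%E) f_int (measurable_cst _) f_eq0.
by apply: filterS => x fx Dx; exact: fx.
Qed.

End ComplexIntegral.

Lemma cintegral_setI d (T : measurableType d) (R : realType) (mu : {measure set T -> \bar R})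
    (D B : set T) (f : T -> R[i]) :
  cintegral mu (D `&` B) f = cintegral mu D (fun x => f x * (\1_B x)%:C%C).
Proof.
by rewrite /cintegral !Rintegral_mkcondr; congr Complex; apply: eq_Rintegral => x _;
  rewrite ?ReM ?ImM patchE indicE; case: ifP => _ /=; rewrite ?mulr1 ?mulr0 ?subr0 ?add0r.
Qed.

Section HaarSteps.
Variables (R : realType) (p : nat) (p_gt0 : (0 < p)%N).
Hypothesis p_gt1 : (1 < p)%N.
Local Notation QP := (QP_ p_gt0).
Local Notation QPm := (QPm p_gt0).
Local Notation pX n := ((p%:R : R) ^ (- n)).
Variable m : {measure set QPm -> \bar R}.
Hypothesis m_haar : haar_measure m.
Implicit Types (N n : int).

Lemma qp_ball_measurable (x : QP) n : measurable (qp_ball x n : set QPm).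
Proof. by apply: sub_sigma_algebra; exists x, n. Qed.

Lemma ae_exists_in_ball (P : QPm -> Prop) (c : QP) n : {ae m, forall x, P x} ->
  exists x, agree n x c /\ P x.
Proof.
move=> [A [mA A0 PA]]; apply: contrapT => nP.
have BA : (qp_ball c n : set QPm) `<=` A.
  by move=> x; rewrite qp_ballE // => xc; apply: PA => /= Px; apply: nP; exists x.
have : (m (qp_ball c n) <= m A)%E.
  by apply: le_measure BA; rewrite inE //; exact: qp_ball_measurable.
by rewrite A0 m_haar lee_fin leNgt exprz_gt0 ?ltr0n.
Qed.

Definition qp_balls0 : set (set QPm) := @qp_balls p p_gt0 `|` [set set0].

Lemma qp_balls0_generate : @measurable _ QPm = <<s qp_balls0 >>.
Proof.
apply/seteqP; split; first by apply: sub_sigma_algebra2 => A; left.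
apply: smallest_sub; first exact: sigma_algebra_measurable.
by move=> A [|->]; [exact: sub_sigma_algebra|exact: measurable0].
Qed.

Lemma qp_balls0_setI_closed : setI_closed qp_balls0.
Proof.
move=> A B [[x [i ->]]|->]; last by rewrite set0I; right.
move=> [[y [j ->]]|->]; last by rewrite setI0; right.
have [->|/set0P[z [zx zy]]] := eqVneq (qp_ball x i `&` qp_ball y j) set0; first by right.
left; exists z, (Num.max i j); move: zx zy; rewrite !qp_ballE // => zx zy.
apply/seteqP; split=> t /= => [[tx ty]|tz].
  have [ij|ji] := leP i j; first exact: agree_trans ty (agree_sym zy).
  exact: agree_trans tx (agree_sym zx).
by split; [apply: agree_trans zx|apply: agree_trans zy]; apply: agree_le tz; lia.
Qed.

Lemma ae_eq0_of_balls (D : set QPm) (f : QPm -> \bar R) : measurable D -> m.-integrable D f ->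
  (\int[m]_(x in D) f x = 0)%E ->
  (forall (y : QP) n, \int[m]_(x in D `&` (qp_ball y n : set QPm)) f x = 0)%E ->
  {ae m, forall x : QPm, D x -> f x = 0%E}.
Proof.
move=> mD f_int f0 ball0.
apply: (ae_eq0_of_setI_closed mD qp_balls0_generate qp_balls0_setI_closed) => //.
by move=> _ [[y [n ->]]|->]; [exact: ball0|rewrite setI0 integral_set0].
Qed.

Definition step (V : Type) n (S : set QP) (f : QP -> V) :=
  forall x y, S x -> S y -> agree n x y -> f x = f y.

Lemma indic_ball_step n (c : QP) (S : set QP) : step n S (\1_(qp_ball c n : set QP) : QP -> R).
Proof.
move=> x y _ _ xy; rewrite !indicE; congr (_%:R : R); congr nat_of_bool.
rewrite qp_ballE //; apply/idP/idP => /set_mem /= h; apply/mem_set => /=.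
  exact: agree_trans (agree_sym xy) h.
exact: agree_trans xy h.
Qed.

Section StepFunctions.
Variables (N n : int) (S : set QPm).
Hypothesis cyl_S : cylinder N n S.
Implicit Types (f : QPm -> R).

Section Transversal.
Variables (F : finType) (a : F -> QP).
Hypothesis trans_a : transversal n S a.

Lemma transversal_bigcup : S = \big[setU/set0]_(g <- index_enum F) (qp_ball (a g) n : set QPm).
Proof.
have [[_ Sn] [Sa cover_a _]] := (cyl_S, trans_a).
rewrite -bigcup_seq; apply/seteqP; split=> [x /cover_a[g xg]|x [g _]].
  by exists g; [exact: mem_index_enum|rewrite qp_ballE].
by rewrite qp_ballE // => xg; apply: Sn (Sa g) _; exact: agree_sym.
Qed.

Lemma transversal_trivIset :
  trivIset [set` index_enum F] (fun g => qp_ball (a g) n : set QPm).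
Proof.
have [_ _ inj_a] := trans_a; move=> g g' _ _ [x []]; rewrite !qp_ballE // => xg xg'.
by apply: inj_a; exact: agree_trans (agree_sym xg) xg'.
Qed.

Lemma sum_transversal_agree (V : nzRingType) (f : QP -> V) x : step n S f -> S x ->
  f x = \sum_g f (a g) * (`[< agree n x (a g) >])%:R.
Proof.
have [Sa cover_a inj_a] := trans_a; move=> f_step Sx; have [g xg] := cover_a x Sx.
rewrite (bigD1 g) //= big1 => [|g' g'g]; first by rewrite asboolT // mulr1 addr0; exact: f_step.
rewrite asboolF ?mulr0 // => xg'; case/eqP: g'g; apply: inj_a.
exact: agree_trans (agree_sym xg') xg.
Qed.

End Transversal.

Lemma cylinder_measurable : measurable S.
Proof.
have [F [a trans_a]] := transversal_exists n cyl_S.1.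
rewrite (transversal_bigcup trans_a); apply: bigsetU_measurable => g _.
exact: qp_ball_measurable.
Qed.

Lemma step_measurable f : step n S f -> measurable_fun S f.
Proof.
have [F [a trans_a]] := transversal_exists n cyl_S.1; move=> f_step.
apply: (eq_measurable_fun (fun x => \sum_g f (a g) * \1_(qp_ball (a g) n : set QPm) x)).
  move=> x /set_mem Sx; rewrite [RHS](sum_transversal_agree trans_a f_step Sx).
  by apply: eq_bigr => g _; rewrite indicE qp_ballE // asboolE.
apply: measurable_sum => g; apply: measurable_funM => //.
exact: measurable_indic (qp_ball_measurable _ _).
Qed.

Lemma step_bounded f : step n S f -> [bounded f x | x in S].
Proof.
have [F [a [Sa cover_a _]]] := transversal_exists n cyl_S.1.
move=> f_step; exists (\sum_g `|f (a g)|); split; first exact: num_real.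
move=> r sum_r x Sx; apply: le_trans (ltW sum_r); have [g xg] := cover_a x Sx.
by rewrite (f_step x (a g)) // (bigD1 g) //= lerDl sumr_ge0.
Qed.

Lemma step_integral (F : finType) (a : F -> QP) f : transversal n S a -> step n S f ->
  (\int[m]_(x in S) (f x)%:E)%E = (pX n * \sum_g f (a g))%:E.
Proof.
move=> trans_a f_step; have SE := transversal_bigcup trans_a.
rewrite {1}SE integral_bigsetU_EFin //=; first last.
- by rewrite -SE; apply/measurable_EFinP; exact: step_measurable.
- exact: transversal_trivIset.
- exact: index_enum_uniq.
- by move=> g; exact: qp_ball_measurable.
rewrite mulr_sumr -sumEFin; apply: eq_bigr => g _.
rewrite (eq_integral (fun=> (f (a g))%:E)).
  by rewrite integral_cst ?m_haar ?EFinM 1?muleC //; exact: qp_ball_measurable.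
move=> x /set_mem; rewrite qp_ballE // => xg; congr EFin.
have [[_ Sn] [Sa _ _]] := (cyl_S, trans_a).
by apply: f_step => //; apply: Sn (Sa g) _; exact: agree_sym.
Qed.

Lemma cylinder_measure (F : finType) (a : F -> QP) : transversal n S a ->
  m S = (#|F|%:R * pX n)%:E.
Proof.
move=> trans_a; have := integral_cst m cylinder_measurable 1; rewrite mul1e => <-.
by rewrite (@step_integral _ _ (fun=> 1) trans_a) // sumr_const mulrC.
Qed.

Lemma cylinder_measure_fin : (m S < +oo)%E.
Proof.
have [F [a trans_a]] := transversal_exists n cyl_S.1.
by rewrite (cylinder_measure trans_a) ltry.
Qed.

Lemma step_integrable f : step n S f -> m.-integrable S (EFin \o f).
Proof.
move=> f_step; apply: measurable_bounded_integrable.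
- exact: cylinder_measurable.
- exact: cylinder_measure_fin.
- exact: step_measurable.
- exact: step_bounded.
Qed.

Lemma step_Re (f : QP -> R[i]) : step n S f -> step n S (fun x => complex.Re (f x)).
Proof. by move=> f_step x y Sx Sy xy; rewrite (f_step x y). Qed.

Lemma step_Im (f : QP -> R[i]) : step n S f -> step n S (fun x => complex.Im (f x)).
Proof. by move=> f_step x y Sx Sy xy; rewrite (f_step x y). Qed.

Lemma step_cintegrable (f : QP -> R[i]) : step n S f -> cintegrable m S f.
Proof. by move=> f_step; split; apply: step_integrable; [exact: step_Re|exact: step_Im]. Qed.

Lemma step_square_cintegrable (f : QP -> R[i]) : step n S f -> square_cintegrable m S f.
Proof.
move=> f_step; split;
  [exact: step_measurable (step_Re f_step)|exact: step_measurable (step_Im f_step)|..];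
  by apply: step_integrable => x y Sx Sy xy; rewrite (f_step x y).
Qed.

Lemma step_cintegral (F : finType) (a : F -> QP) (f : QP -> R[i]) : transversal n S a ->
  step n S f -> cintegral m S f = (pX n)%:C%C * \sum_g f (a g).
Proof.
move=> trans_a f_step; apply/cintegralP;
  [exact: cylinder_measurable|exact: step_cintegrable|].
rewrite (step_integral trans_a (step_Re f_step)) (step_integral trans_a (step_Im f_step)).
by rewrite ReM ImM Re_sum Im_sum /= !mul0r subr0 addr0.
Qed.

Lemma cintegrableM_step (f g : QPm -> R[i]) : cintegrable m S f -> step n S g ->
  cintegrable m S (fun x => f x * g x).
Proof.
move=> f_int g_step; apply: cintegrableM_bounded => //.
- exact: cylinder_measurable.
- exact: step_measurable (step_Re g_step).
- exact: step_bounded (step_Re g_step).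
- exact: step_measurable (step_Im g_step).
- exact: step_bounded (step_Im g_step).
Qed.

End StepFunctions.

End HaarSteps.

(** * Spectra *)

Section CharacterIntegrals.
Variables (R : realType) (p : nat) (p_gt0 : (0 < p)%N).
Hypothesis p_gt1 : (1 < p)%N.
Local Notation QP := (QP_ p_gt0).
Local Notation QPm := (QPm p_gt0).
Local Notation chi := (chi R).
Local Notation pX n := ((p%:R : R) ^ (- n)).
Variable m : {measure set QPm -> \bar R}.
Hypothesis m_haar : haar_measure m.
Implicit Types (N n k : int) (I : set int) (S : set QPm) (l d x : QP).

Lemma chi_step n S l : zero_below (- n) l -> step n S (chi l).
Proof. by move=> nl x y _ _; exact: chi_agree. Qed.

Lemma chi_cintegrable N n S l : cylinder N n S -> cintegrable m S (chi l).
Proof.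
move=> cyl_S; have [n' [nn' n'l]] := zero_below_level n l.
exact: (step_cintegrable p_gt1 m_haar (cylinder_le nn' cyl_S)) (chi_step n'l).
Qed.

Lemma cintegral_chi0 N n S : cylinder N n S -> cintegral m S (chi 0) = (fine (m S))%:C%C.
Proof.
move=> cyl_S; have [F [a trans_a]] := transversal_exists n cyl_S.1.
rewrite (step_cintegral p_gt1 m_haar cyl_S trans_a); last exact: chi_step.
rewrite (cylinder_measure p_gt1 m_haar cyl_S trans_a) (eq_bigr (fun=> 1)) => [|g _].
  by rewrite sumr_const -(rmorph_nat (real_complex R)) -rmorphM mulrC.
exact: chi0l.
Qed.

Lemma tree_cintegral_chi I S N n k d : tree I S -> cylinder N n S ->
  zero_below k d -> digit d k <> 0%N -> I (- k - 1) -> cintegral m S (chi d) = 0.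
Proof.
move=> tree_S cyl_S kd dk0 Ik; have [_ split_S branch_S] := tree_S.
pose n' := Num.max n (- k); have nn' : n <= n' by rewrite /n'; lia.
have cyl_S' := cylinder_le nn' cyl_S.
have [F [a trans_a]] := transversal_exists n' cyl_S.1.
rewrite (step_cintegral p_gt1 m_haar cyl_S' trans_a); last first.
  by apply: chi_step; apply: zero_below_le kd; rewrite /n'; lia.
have Nk := tree_orders_ge p_gt1 tree_S cyl_S.1 Ik.
have trans_aN : transversal n' (S `&` zero_below N) a by rewrite (setIidl cyl_S.1).
rewrite (tree_sum_chi R p_gt1 split_S branch_S trans_aN kd dk0 Ik) ?mulr0 //.
by rewrite Nk /n'; lia.
Qed.

Lemma cintegral_ball_chi n (c : QP) d :
  cintegral m (qp_ball c n : set QPm) (chi d) =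
  if `[< zero_below (- n) d >] then (pX n)%:C%C * chi d c else 0.
Proof.
have [N [Nn Nc _]] := zero_below2 n c c; have cyl_B := qp_ball_cylinder p_gt1 Nc Nn.
case: asboolP => [nd|nd].
  have trans_c : transversal n (qp_ball c n) (fun _ : unit => c).
    split=> [_|x|[] []//]; first exact: mem_qp_ball.
    by rewrite qp_ballE //; exists tt.
  rewrite (step_cintegral p_gt1 m_haar cyl_B trans_c); last exact: chi_step.
  by rewrite big_const card_unit /= addr0.
have [k [kn dk dk0]] : exists k, [/\ k < - n, agree k d 0 & digit d k <> 0%N].
  by apply: first_difference => nd0; apply: nd => j jn; rewrite nd0.
apply: (tree_cintegral_chi (qp_ball_tree p_gt1 n c) cyl_B (k := k)) => //=; lia.
Qed.

End CharacterIntegrals.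

Definition dual_orders (I : set int) : set int := [set j | I (- j - 1)].

Lemma order_count_dual (I : set int) (M : int) (L : nat) :
  order_count (- (M + L%:Z)) L (dual_orders I) = order_count M L I.
Proof.
rewrite /order_count -!sum1_card (reindex_inj rev_ord_inj) /=; apply: eq_bigl => i.
rewrite !inE; apply: asbool_equiv_eq; rewrite /dual_orders /=.
by have -> : - (- (M + L%:Z) + (L - i.+1)%N%:Z) - 1 = M + (i : nat)%:Z by have := ltn_ord i; lia.
Qed.

Section Spectrum.
Variables (R : realType) (p : nat) (p_gt0 : (0 < p)%N).
Hypothesis p_prime : prime p.
Let p_gt1 : (1 < p)%N := prime_gt1 p_prime.
Local Notation QP := (QP_ p_gt0).
Local Notation QPm := (QPm p_gt0).
Local Notation chi := (chi R).
Local Notation pX n := ((p%:R : R) ^ (- n)).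
Variable m : {measure set QPm -> \bar R}.
Hypothesis m_haar : haar_measure m.
Variables (I : set int) (Om : set QPm) (M n0 : int).
Hypotheses (tree_Om : tree I Om) (cyl_Om : cylinder M n0 Om).
Local Notation J := (dual_orders I).
Implicit Types (Lam : set QPm) (l x c : QP).

Let split_Om : splits_within I Om. Proof. by case: tree_Om. Qed.
Let branch_Om : branches_at I Om. Proof. by case: tree_Om. Qed.
Let mOm : measurable Om := cylinder_measurable p_gt1 cyl_Om.
Let chi_int l : cintegrable m Om (chi l) := chi_cintegrable p_gt1 m_haar l cyl_Om.

Definition chi_orthogonal Lam := forall l l', Lam l -> Lam l' ->
  cintegral m Om (chi (l - l')) = (fine (m Om))%:C%C * (l == l')%:R.

Definition chi_complete Lam := forall f : QPm -> R[i], square_cintegrable m Om f ->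
  (forall l, Lam l -> cintegral m Om (fun x => f x * chi (- l) x) = 0) ->
  {ae m, forall x : QPm, Om x -> f x = 0}.

Lemma fine_measure_gt0 : 0 < fine (m Om).
Proof.
have [F [a trans_a]] := transversal_exists n0 cyl_Om.1.
have [[[s Os] _ _] [_ cover_a _]] := (tree_Om, trans_a); have [g0 _] := cover_a s Os.
rewrite (cylinder_measure p_gt1 m_haar cyl_Om trans_a) /= mulr_gt0 ?exprz_gt0 ?ltr0n //.
by apply/card_gt0P; exists g0.
Qed.

Lemma orthonormalP l l' :
  ((\int[m]_(x in Om) ((fine (m Om))^-1 * cos (theta R l x - theta R l' x))%:E
      = (if l == l' then 1 else 0)%:E)%E /\
   (\int[m]_(x in Om) ((fine (m Om))^-1 * sin (theta R l x - theta R l' x))%:E = 0)%E) <->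
  cintegral m Om (chi (l - l')) = (fine (m Om))%:C%C * (l == l')%:R.
Proof.
have m0 : (fine (m Om))%:C%C != 0 :> R[i].
  by rewrite fmorph_eq0 gt_eqF // fine_measure_gt0.
have chiE x : ((fine (m Om))^-1)%:C%C * chi (l - l') x =
    Complex ((fine (m Om))^-1 * cos (theta R l x - theta R l' x))
            ((fine (m Om))^-1 * sin (theta R l x - theta R l' x)).
  by rewrite chiBl // /chi -cisN -cisD; apply/eqP; rewrite eq_complex /= !mul0r subr0 addr0 !eqxx.
have := cintegralP mOm (if l == l' then 1 else 0)
  (cintegrableZ mOm ((fine (m Om))^-1)%:C%C (chi_int (l - l'))).
rewrite cintegralZ //; under eq_integral do rewrite chiE.
under [X in _ /\ X = _ <-> _]eq_integral do rewrite chiE.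
have -> : complex.Re (if l == l' then 1 else 0 : R[i]) = if l == l' then 1 else 0 by case: ifP.
have -> : complex.Im (if l == l' then 1 else 0 : R[i]) = 0 by case: ifP.
move=> ->; rewrite fmorphV; split=> [e|->].
  by rewrite -[LHS](mulVKf m0) e; case: eqP.
by rewrite mulKf //; case: eqP.
Qed.

Lemma orthogonal_pairingP (u v : QPm -> R) l :
  cintegrable m Om (fun x => Complex (u x) (v x)) ->
  ((\int[m]_(x in Om) (u x * cos (theta R l x) + v x * sin (theta R l x))%:E = 0)%E /\
   (\int[m]_(x in Om) (v x * cos (theta R l x) - u x * sin (theta R l x))%:E = 0)%E) <->
  cintegral m Om (fun x => Complex (u x) (v x) * chi (- l) x) = 0.
Proof.
move=> uv_int; have [n [n0n nl]] := zero_below_level n0 (- l).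
have := cintegralP mOm 0
  (cintegrableM_step p_gt1 (cylinder_le n0n cyl_Om) uv_int (chi_step R p_gt1 nl)).
have chiE x : Complex (u x) (v x) * chi (- l) x =
    Complex (u x * cos (theta R l x) + v x * sin (theta R l x))
            (v x * cos (theta R l x) - u x * sin (theta R l x)).
  by rewrite chiNl //; apply/eqP; rewrite eq_complex /= !mulrN opprK [- _ + _]addrC !eqxx.
under eq_integral do rewrite chiE.
by under [X in _ /\ X = _ <-> _]eq_integral do rewrite chiE.
Qed.

Lemma spectrum_complexP Lam : spectrum m Om Lam <-> chi_orthogonal Lam /\ chi_complete Lam.
Proof.
have square_int := square_cintegrable_cintegrable mOm (cylinder_measure_fin p_gt1 m_haar cyl_Om).
split=> [[orth compl]|[orth compl]]; split.
- by move=> l l' Ll Ll'; apply/orthonormalP; exact: orth.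
- move=> f f2 f_orth; have [mRe mIm Re2 Im2] := f2.
  have fE : f = fun x => Complex (complex.Re (f x)) (complex.Im (f x)).
    by apply/funext => x; case: (f x).
  have f_int := square_int _ f2; rewrite fE in f_int f_orth.
  have := compl _ _ mRe mIm Re2 Im2 (fun l Ll => iffRL (orthogonal_pairingP l f_int) (f_orth l Ll)).
  apply: filterS => x fx0 Ox; have [Re0 Im0] := fx0 Ox.
  by apply/eqP; rewrite eq_complex Re0 Im0 !eqxx.
- by move=> l l' Ll Ll'; apply/orthonormalP; exact: orth.
- move=> u v mu mv u2 v2 uv_orth.
  have uv2 : square_cintegrable m Om (fun x => Complex (u x) (v x)) by split.
  have := compl _ uv2 (fun l Ll => iffLR (orthogonal_pairingP l (square_int _ uv2)) (uv_orth l Ll)).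
  by apply: filterS => x uvx0 Ox; have [-> ->] := uvx0 Ox.
Qed.

Lemma dual_order_lt j : J j -> j < - M.
Proof. by move=> /(tree_orders_ge p_gt1 tree_Om cyl_Om.1); lia. Qed.

Lemma splits_within_dual_eq Lam l l' : splits_within J Lam -> Lam l -> Lam l' ->
  agree (- M) l l' -> l = l'.
Proof.
move=> split_Lam Ll Ll' ll'; apply: agree_eq => k.
apply: (splits_within_agree split_Lam) => // j _ Jj.
by apply: ll'; exact: dual_order_lt.
Qed.

Lemma chi_orthogonal_splits Lam : chi_orthogonal Lam -> splits_within J Lam.
Proof.
move=> orth l l' k Ll Ll' ll' nJ; apply: contrapT => dk.
pose d := l - l'; have kd : zero_below k d by apply/agreeP.
have [n [n0n nd]] := zero_below_level n0 d.
have cyl_n := cylinder_le n0n cyl_Om; have [F [a trans_a]] := transversal_exists n cyl_n.1.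
have : \sum_g chi d (a g) = 0.
  have := orth l l' Ll Ll'; have -> : (l == l') = false by apply/eqP => le; rewrite le in dk.
  rewrite (step_cintegral p_gt1 m_haar cyl_n trans_a (chi_step R p_gt1 nd)) mulr0 => /eqP.
  by rewrite mulf_eq0 fmorph_eq0 expfz_eq0 pnatr_eq0 -leqn0 leqNgt p_gt0 andbF => /eqP.
have [[[s Os] _ _] [Oa cover_a _]] := (tree_Om, trans_a); have [g0 _] := cover_a s Os.
have Ma g : zero_below M (a g) by apply: cyl_Om.1.
move=> /(sum_chi_eq0_split p_gt1 g0 p_prime Ma kd (digitB_neq0 ll' dk))[g [g' [gg' dg]]].
by apply: dg; exact: split_Om gg' nJ.
Qed.

Section Residual.
Variables (Lam : set QPm) (n : int) (F G : finType) (a : F -> QP) (l : G -> QP) (c : QP).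
Hypotheses (n0n : n0 <= n) (orth : chi_orthogonal Lam) (Oc : Om c).
Hypothesis trans_l : transversal (- M) (Lam `&` zero_below (- n)) l.
Hypothesis trans_a : transversal n Om a.

Let cyl_n := cylinder_le n0n cyl_Om.

(* The difference between the indicator of the ball of [c] and its orthogonal
   projection on the span of the characters [l h]. *)
Definition ball_residual (x : QPm) : R[i] :=
  (\1_(qp_ball c n : set QPm) x)%:C%C - #|F|%:R^-1 * \sum_h chi (l h) (x - c).

Lemma ball_residual_step : step n Om ball_residual.
Proof.
move=> x y Ox Oy xy; rewrite /ball_residual (indic_ball_step R p_gt1 c Ox Oy xy).
congr (_ - _ * _); apply: eq_bigr => h _; have [/(_ h)[_ nl] _ _] := trans_l.
by apply: (chi_agree R p_gt1 nl); apply/agreeDr.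
Qed.

Lemma ball_residual_orthogonal lam : Lam lam ->
  cintegral m Om (fun x => ball_residual x * chi (- lam) x) = 0.
Proof.
move=> Llam; pose B : set QPm := qp_ball c n; pose K : R[i] := #|F|%:R.
have ballE : (fun x => ball_residual x * chi (- lam) x) = (fun x =>
    chi (- lam) x * (\1_B x)%:C%C + \sum_h - (K^-1 * chi (l h) (- c)) * chi (l h - lam) x).
  apply/funext => x; rewrite /ball_residual mulrBl mulrC; congr (_ + _).
  rewrite -mulrA mulr_suml mulr_sumr -sumrN; apply: eq_bigr => h _.
  by rewrite chiDr // chiDl // !mulNr; congr (- _); ring.
have indic_step : step n Om (fun x => (\1_B x)%:C%C : R[i]).
  by move=> x y Ox Oy xy; rewrite (indic_ball_step R p_gt1 c Ox Oy xy).
have BO : B `<=` Om.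
  by move=> x; rewrite /B qp_ballE // => xc; apply: cyl_n.2 Oc _; exact: agree_sym.
have first_int := cintegrableM_step p_gt1 cyl_n (chi_int (- lam)) indic_step.
have term_int h : cintegrable m Om (fun x => - (K^-1 * chi (l h) (- c)) * chi (l h - lam) x).
  by apply: cintegrableZ mOm _ _ _; exact: chi_int.
rewrite ballE (cintegralD mOm first_int) ?(cintegral_sum mOm) //; last exact: cintegrable_sum.
have [Ll cover_l inj_l] := trans_l.
under eq_bigr => h _ do rewrite (cintegralZ mOm) ?(orth (Ll h).1 Llam) //.
rewrite -cintegral_setI (setIidr BO) cintegral_ball_chi //.
case: asboolP => [/zero_belowN|nlam]; last first.
  rewrite big1 ?addr0 // => h _; case: eqP => [lE|_]; last by rewrite !mulr0.
  by case: nlam; apply: zero_belowN; rewrite -lE; exact: (Ll h).2.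
rewrite opprK => nlam; have [h lamE] := cover_l lam (conj Llam nlam).
have {}lamE : l h = lam.
  apply: (splits_within_dual_eq (chi_orthogonal_splits orth)) => //; first exact: (Ll h).1.
  exact: agree_sym.
rewrite (bigD1 h) //= big1 => [|h' h'h]; last first.
  case: eqP => [lE|_]; last by rewrite !mulr0.
  by case/eqP: h'h; apply: inj_l; rewrite lE lamE.
have K0 : K != 0.
  have [_ cover_a _] := trans_a; have [g0 _] := cover_a c Oc.
  by rewrite pnatr_eq0 -lt0n; apply/card_gt0P; exists g0.
rewrite lamE eqxx (cylinder_measure p_gt1 m_haar cyl_n trans_a) /= rmorphM rmorph_nat chiNr //.
by rewrite -/K; field.
Qed.

Lemma chi_complete_card : chi_complete Lam -> #|G| = #|F|.
Proof.
move=> compl; have f2 := step_square_cintegrable p_gt1 m_haar cyl_n ball_residual_step.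
have [x [xc fx0]] := ae_exists_in_ball p_gt1 m_haar c n (compl _ f2 ball_residual_orthogonal).
have Ox : Om x by apply: cyl_n.2 Oc _; exact: agree_sym.
have [_ cover_a _] := trans_a; have [g0 _] := cover_a c Oc.
have K0 : #|F|%:R != 0 :> R[i] by rewrite pnatr_eq0 -lt0n; apply/card_gt0P; exists g0.
have := fx0 Ox; rewrite /ball_residual indicE mem_set; last by rewrite qp_ballE.
rewrite (eq_bigr (fun=> 1)) => [|h _]; last first.
  have [/(_ h)[_ nl] _ _] := trans_l.
  by apply: (chi_eq1 R p_gt1 nl); apply/agreeP.
rewrite sumr_const rmorph1 => /eqP; rewrite subr_eq0 => /eqP/(congr1 (fun t => #|F|%:R * t)).
by rewrite mulr1 mulVKf // => /eqP; rewrite eqr_nat => /eqP.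
Qed.

End Residual.

Lemma spectrum_tree Lam : spectrum m Om Lam -> tree J Lam.
Proof.
move=> /spectrum_complexP[orth compl]; have split_Lam := chi_orthogonal_splits orth.
apply: (tree_of_card (N0 := Num.min (- n0) (- M)) dual_order_lt split_Lam) => N L N_le NE.
have [nE N_n] : M + L%:Z = - N /\ N = - (M + L%:Z) by split; lia.
have LamN : Lam `&` zero_below N `<=` zero_below N by move=> x [].
have [G [l trans_l]] := transversal_exists (- M) LamN.
have n0n : n0 <= M + L%:Z by lia.
have [F [a trans_a]] := transversal_exists (M + L%:Z) cyl_Om.1.
exists G, l; split=> //; have [[c Oc] _ _] := tree_Om; rewrite N_n in trans_l *.
rewrite (chi_complete_card n0n orth Oc trans_l trans_a compl) order_count_dual.
have trans_aM : transversal (M + L%:Z) (Om `&` zero_below M) a by rewrite (setIidl cyl_Om.1).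
apply: (tree_card_transversal split_Om trans_aM branch_Om).
by exists c; split=> //; exact: cyl_Om.1.
Qed.

Section TreeIsSpectrum.
Variable Lam : set QPm.
Hypothesis tree_Lam : tree J Lam.

Let split_Lam : splits_within J Lam. Proof. by case: tree_Lam. Qed.
Let branch_Lam : branches_at J Lam. Proof. by case: tree_Lam. Qed.

Lemma tree_chi_orthogonal : chi_orthogonal Lam.
Proof.
move=> l l' Ll Ll'; have [<-|/eqP ll'] := eqVneq l l'.
  by rewrite subrr (cintegral_chi0 p_gt1 m_haar cyl_Om) mulr1.
have [k [ll'k dk]] := first_difference_neq ll'; rewrite mulr0.
apply: (tree_cintegral_chi p_gt1 m_haar tree_Om cyl_Om (k := k)); first exact/agreeP.
  exact: digitB_neq0.
by apply: contrapT => nJ; apply: dk; exact: split_Lam ll'k nJ.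
Qed.

Section DualTransversal.
Variables (n : int) (G : finType) (l : G -> QP).
Hypothesis trans_l : transversal (- M) (Lam `&` zero_below (- n)) l.

(* The vanishing sums over [Om] with the roles of [Om] and [Lam] exchanged. *)
Lemma dual_sum_chi x c : Om x -> Om c ->
  \sum_h chi (l h) (x - c) = #|G|%:R * (`[< agree n c x >])%:R.
Proof.
move=> Ox Oc; case: asboolP => [xc|].
  rewrite (eq_bigr (fun=> 1)) ?sumr_const ?mulr1 // => h _.
  have [/(_ h)[_ nl] _ _] := trans_l.
  by apply: (chi_eq1 R p_gt1 nl); apply/agreeP/agree_sym.
move=> /first_difference[k [kn /agree_sym cx dk]]; rewrite mulr0.
have Ik : I k by apply: contrapT => nI; apply: dk; apply/esym; exact: split_Om cx nI.
under eq_bigr do rewrite chiC //.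
apply: (tree_sum_chi R p_gt1 split_Lam branch_Lam trans_l (k := k)); first exact/agreeP.
- by apply: digitB_neq0 => // /esym.
- by rewrite /dual_orders /=; have -> : - (- k - 1) - 1 = k by lia.
- by have := tree_orders_ge p_gt1 tree_Om cyl_Om.1 Ik; lia.
Qed.

Lemma step_chi_expansion (f : QP -> R[i]) (g0 : G) : cylinder M n Om -> step n Om f ->
  exists b : G -> R[i], forall x, Om x -> f x = \sum_h b h * chi (- l h) x.
Proof.
move=> cyl_n f_step; have [F [a trans_a]] := transversal_exists n cyl_n.1.
have G0 : #|G|%:R != 0 :> R[i] by rewrite pnatr_eq0 -lt0n; apply/card_gt0P; exists g0.
exists (fun h => \sum_g f (a g) * (#|G|%:R^-1 * chi (l h) (a g))) => x Ox.
rewrite (sum_transversal_agree trans_a f_step Ox).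
under [RHS]eq_bigr do rewrite mulr_suml.
rewrite exchange_big /=; apply: eq_bigr => g _; have [/(_ g) Oa _ _] := trans_a.
under eq_bigr do rewrite -mulrA; rewrite -mulr_sumr; congr (_ * _).
under eq_bigr do rewrite -mulrA -chiNr // -chiDr //.
by rewrite -mulr_sumr dual_sum_chi // mulKf.
Qed.

End DualTransversal.

Lemma orthogonal_step_eq0 (f : QPm -> R[i]) : cintegrable m Om f ->
  (forall l, Lam l -> cintegral m Om (fun x => f x * chi (- l) x) = 0) ->
  forall n g, step n Om g -> cintegral m Om (fun x => f x * g x) = 0.
Proof.
move=> f_int f_orth n g g_step; have [[l0 Ll0] _ _] := tree_Lam.
have [n' [nn' nl0]] := zero_below_level (Num.max (Num.max n n0) M) l0.
have cyl_n' : cylinder M n' Om by apply: cylinder_le cyl_Om; lia.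
have LamN : Lam `&` zero_below (- n') `<=` zero_below (- n') by move=> x [].
have [G [l trans_l]] := transversal_exists (- M) LamN.
have [Ll cover_l _] := trans_l; have [h0 _] := cover_l l0 (conj Ll0 nl0).
have g_step' : step n' Om g by move=> x y Ox Oy xy; apply: g_step => //; apply: agree_le xy; lia.
have [b gE] := step_chi_expansion trans_l h0 cyl_n' g_step'.
have chi_step_l h : step n' Om (chi (- l h)).
  by apply: chi_step => //; apply: zero_belowN; exact: (Ll h).2.
have term_int h := cintegrableM_step p_gt1 cyl_n' f_int (chi_step_l h).
transitivity (cintegral m Om (fun x => \sum_h b h * (f x * chi (- l h) x))).
  apply: eq_cintegral => x /set_mem Ox; rewrite gE // mulr_sumr.
  by apply: eq_bigr => h _; rewrite mulrCA.
rewrite (cintegral_sum mOm) => [|h]; last exact: cintegrableZ.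
by rewrite big1 // => h _; rewrite (cintegralZ mOm) // f_orth ?mulr0 //; exact: (Ll h).1.
Qed.

Lemma tree_chi_complete : chi_complete Lam.
Proof.
move=> f f2 f_orth.
have f_int := square_cintegrable_cintegrable mOm (cylinder_measure_fin p_gt1 m_haar cyl_Om) f2.
have step0 := orthogonal_step_eq0 f_int f_orth.
have f_setI n y : cintegral m (Om `&` (qp_ball y n : set QPm)) f = 0.
  rewrite cintegral_setI; apply: (step0 n) => x x' Ox Ox' xx'.
  by rewrite (indic_ball_step R p_gt1 y Ox Ox' xx').
have f_Om : cintegral m Om f = 0.
  rewrite -[RHS](step0 n0 (fun=> 1)) //; apply: eq_cintegral => x _.
  by rewrite mulr1.
have [[Re0 Im0] [fRe fIm]] := (iffRL (cintegralP mOm 0 f_int) f_Om, f_int).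
have ball0 (y : QP) n :
    (\int[m]_(x in Om `&` (qp_ball y n : set QPm)) (complex.Re (f x))%:E = 0)%E /\
    (\int[m]_(x in Om `&` (qp_ball y n : set QPm)) (complex.Im (f x))%:E = 0)%E.
  have mOmB : measurable (Om `&` (qp_ball y n : set QPm)).
    by apply: measurableI => //; exact: qp_ball_measurable.
  have fB_int : cintegrable m (Om `&` (qp_ball y n : set QPm)) f.
    by split; [apply: integrableS fRe|apply: integrableS fIm].
  exact: (iffRL (cintegralP mOmB 0 fB_int) (f_setI n y)).
have aeRe := ae_eq0_of_balls p_gt1 mOm fRe Re0 (fun y n => (ball0 y n).1).
have aeIm := ae_eq0_of_balls p_gt1 mOm fIm Im0 (fun y n => (ball0 y n).2).
apply: filterS2 aeRe aeIm => x fRe0 fIm0 Ox; apply/eqP; rewrite eq_complex.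
by have [[->] [->]] := (fRe0 Ox, fIm0 Ox); rewrite eqxx.
Qed.

Lemma tree_spectrum : spectrum m Om Lam.
Proof.
by apply/spectrum_complexP; split; [exact: tree_chi_orthogonal|exact: tree_chi_complete].
Qed.

End TreeIsSpectrum.

Lemma spectrumP Lam : spectrum m Om Lam <-> tree J Lam.
Proof. by split; [exact: spectrum_tree|exact: tree_spectrum]. Qed.

End Spectrum.

(** * Tilings *)

Section TreeSums.
Variables (p : nat) (p_gt0 : (0 < p)%N).
Local Notation QP := (QP_ p_gt0).
Implicit Types (x y s t : QP) (n k : int) (I : set int) (S T : set QP).

Lemma complementary_trees_sum I S T n x : tree I S -> tree (~` I) T ->
  exists s t, [/\ S s, T t & agree n x (s + t)].
Proof.
move=> [[s0 Ss0] _ branch_S] [[t0 Tt0] _ branch_T].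
have [N1 [N1n Nx Ns]] := zero_below2 n x s0; have [N [NN1 Nt _]] := zero_below2 N1 t0 t0.
have sum_up (k : nat) : exists s t, [/\ S s, T t & agree (N + k%:Z) x (s + t)].
  elim: k => [|k [s [t [Ss Tt xst]]]].
    exists s0, t0; split=> //; rewrite addr0.
    apply: zero_below_agree; first exact: zero_below_le Nx.
    by apply: zero_belowD => //; exact: zero_below_le Ns.
  have -> : N + k.+1%:Z = N + k%:Z + 1 by lia.
  have [Ik|nIk] := pselect (I (N + k%:Z)).
    have [s' [Ss' ss' ds']] := branch_S s _ (Ordinal (digit_lt (x - t) (N + k%:Z))) Ss Ik.
    exists s', t; split=> //; apply/agree_subl; apply: agreeS => //.
    by apply: agree_trans ss'; apply/agree_subl.
  have [t' [Tt' tt' dt']] := branch_T t _ (Ordinal (digit_lt (x - s) (N + k%:Z))) Tt nIk.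
  exists s, t'; split=> //; rewrite [s + t']addrC; apply/agree_subl; apply: agreeS => //.
  by apply: agree_trans tt'; apply/agree_subl; rewrite [t + s]addrC.
have [s [t [Ss Tt xst]]] := sum_up `|n - N|%N; exists s, t; split=> //.
by apply: agree_le xst; lia.
Qed.

Lemma complementary_splits_eq I S T x t t' : splits_within I S -> splits_within (~` I) T ->
  T t -> T t' -> S (x - t) -> S (x - t') -> t = t'.
Proof.
move=> split_S split_T Tt Tt' St St'; apply: contrapT => /first_difference_neq[k [tt' dk]].
have nIk : ~ I k by move=> Ik; apply: dk; apply: split_T tt' _ => //; exact.
have : agree (k + 1) t t'.
  by apply/(agreeBl _ x); apply: agreeS; [|apply: split_S => //]; exact/agreeBl.
by move=> /(_ k); rewrite ltrDl => /(_ isT).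
Qed.

Lemma order_count_setT N L : order_count N L [set: int] = L.
Proof.
by rewrite /order_count -[RHS]card_ord; apply: eq_card => i; rewrite !inE asboolT.
Qed.

Lemma order_countC N L I : (order_count N L I + order_count N L (~` I) = L)%N.
Proof.
rewrite /order_count -[RHS]card_ord -(cardC [pred i : 'I_L | `[< I (N + (i : nat)%:Z) >]]).
by congr (_ + _)%N; apply: eq_card => i; rewrite !inE asbool_neg.
Qed.

End TreeSums.

Lemma exists_coprime_combination (p L : nat) (d d' : int) :
  prime p -> ~~ (p %| d)%Z -> ~~ (p %| d')%Z ->
  exists k : nat, [/\ (0 < k)%N, coprime k p & ((p ^ L)%N%:Z %| k%:Z * d + d')%Z].
Proof.
move=> p_prime pd pd'; have [->|L0] := posnP L.
  by exists 1%N; rewrite expn0 coprime1n dvd1z.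
pose P : int := (p ^ L)%N%:Z.
have : coprimez d P by rewrite coprimezE /= coprime_sym coprime_pexpl // prime_coprime.
move=> /coprimezP[[u v] /= uv]; pose k := ((- d' * u) %% P)%Z.
have k_ge0 : 0 <= k by rewrite modz_ge0 // /P eqz_nat expn_eq0 -leqn0 leqNgt prime_gt0.
have kd : (P %| k * d + d')%Z.
  apply/dvdz_mod0P; rewrite -modzDml modzMml modzDml; apply/dvdz_mod0P.
  have -> : - d' * u * d + d' = d' * v * P by rewrite -[X in _ + X]mulr1 -uv; ring.
  exact: dvdz_mull.
have pk : ~~ (p%:Z %| k)%Z.
  apply: contra pd' => pk; have pP : (p%:Z %| P)%Z by rewrite dvdzE /= dvdn_exp.
  by have := dvdz_trans pP kd; rewrite rpredDl // dvdz_mulr.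
exists `|k|%N; split.
- by rewrite absz_gt0; apply: contraNneq pk => ->; rewrite dvdz0.
- by rewrite coprime_sym prime_coprime // -[p]/(`|p%:Z|%N) -dvdzE.
- by rewrite gez0_abs.
Qed.

(* A multiple [k a + b] with [k] prime to [p] would otherwise have a collision. *)
Lemma direct_mod_orders_disjoint (p L i : nat) (A B : finType) (a : A -> nat) (b : B -> nat)
    (x x' : A) (y y' : B) (d d' : int) :
  prime p -> (#|A| * #|B| = p ^ L)%N -> direct_mod (p ^ L) a b ->
  (a x)%:Z - (a x')%:Z = (p ^ i)%N%:Z * d -> (b y)%:Z - (b y')%:Z = (p ^ i)%N%:Z * d' ->
  ~~ (p %| d)%Z -> ~~ (p %| d')%Z -> False.
Proof.
move=> p_prime cardAB ab ad bd' pd pd'.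
have pX_gt0 j : (0 < p ^ j)%N by rewrite expn_gt0 prime_gt0.
have [k [k_gt0 kp kd]] := exists_coprime_combination L p_prime pd pd'.
have kpL : coprime k (p ^ L) by rewrite coprimeXr.
have kab := direct_mod_coprime (pX_gt0 L) cardAB k_gt0 kpL ab.
have [|xx' _] := kab x x' y y'.
  apply/eqP; rewrite -eqz_nat -!modz_nat eqz_mod_dvd.
  have -> : (k * a x + b y)%N%:Z - (k * a x' + b y')%N%:Z = (p ^ i)%N%:Z * (k%:Z * d + d').
    by rewrite !PoszD !PoszM mulrDr mulrCA -ad -bd'; ring.
  exact: dvdz_mull.
move: ad; rewrite xx' subrr => /esym/eqP; rewrite mulf_eq0 eqz_nat gtn_eqF //= => /eqP d0.
by rewrite d0 dvdz0 in pd.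
Qed.

Lemma esum_indic_eq1 (R : realType) (T : choiceType) (A : set T) (P : T -> bool) :
  (\esum_(t in A) ((P t)%:R : R)%:E = 1)%E <-> exists! t, A t /\ P t.
Proof.
have split_at t : A t -> P t -> (\esum_(t in A) ((P t)%:R : R)%:E =
    1 + \esum_(t in A `&` ~` [set t]) ((P t)%:R : R)%:E)%E.
  move=> At Pt; rewrite (esumID [set t]) => [|s _]; last by rewrite lee_fin.
  congr (_ + _)%E; have -> : A `&` [set t] = [set t] by apply/seteqP; split=> [s []//|s ->].
  by rewrite esum_set1 ?Pt // lee_fin.
split=> [sum1|[t [[At Pt] uniq_t]]]; last first.
  rewrite (split_at t) // esum1 ?adde0 // => s [As st].
  by case: (boolP (P s)) => // Ps; case: st; apply/esym/uniq_t.
have [t [At Pt]] : exists t, A t /\ P t.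
  apply: contrapT => nt; move: sum1; rewrite esum1 => [/eqP|t At].
    by rewrite eqe eq_sym oner_eq0.
  by case: (boolP (P t)) => // Pt; case: nt; exists t.
exists t; split=> // s [As Ps]; apply: contrapT => ts.
have : (1 + 1 <= 1 :> \bar R)%E.
  rewrite -[leRHS]sum1 (split_at t) // leeD2l //; apply: esum_ge.
  exists [set s]; last by rewrite fsbig_set1 Ps.
  by split=> [|r ->]; [exact: finite_set1|split=> // /esym].
by rewrite -EFinD lee_fin; lra.
Qed.

Section Tiling.
Variables (R : realType) (p : nat) (p_gt0 : (0 < p)%N).
Hypothesis p_prime : prime p.
Let p_gt1 : (1 < p)%N := prime_gt1 p_prime.
Local Notation QP := (QP_ p_gt0).
Local Notation QPm := (QPm p_gt0).
Variables (I : set int) (Om : set QPm) (M n0 : int).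
Hypotheses (tree_Om : tree I Om) (cyl_Om : cylinder M n0 Om).
Implicit Types (T : set QP) (s t : QP).

Let split_Om : splits_within I Om. Proof. by case: tree_Om. Qed.
Let branch_Om : branches_at I Om. Proof. by case: tree_Om. Qed.

Definition exact_tiling T := forall x : QP, exists! t, T t /\ Om (x - t).

Lemma tiling_complementP (m : {measure set QPm -> \bar R}) (T : set QPm) :
  haar_measure m -> tiling_complement m Om T <-> exact_tiling T.
Proof.
move=> m_haar; have sum_at (x : QPm) : (\esum_(t in T) (\1_Om (qp_sub x t) : R)%:E = 1)%E <->
    exists! t, T t /\ Om ((x : QP) - t).
  under eq_esum do rewrite indicE qp_subE.
  rewrite esum_indic_eq1; split=> -[t [[Tt Ot] uniq_t]]; exists t.
    split=> [|t' [Tt' Ot']]; first by split=> //; exact: set_mem.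
    by apply: uniq_t; split=> //; exact: mem_set.
  split=> [|t' [Tt' /set_mem Ot']]; first by split=> //; exact: mem_set.
  exact: uniq_t.
split=> [tile x|tile]; last by apply: aeW => x; exact/sum_at.
have [y [yx /sum_at[t [[Tt Ot] uniq_t]]]] := ae_exists_in_ball p_gt1 m_haar x n0 tile.
have translate s : agree n0 (y - s) (x - s) by apply/agreeDr.
exists t; split; first by split=> //; exact: cyl_Om.2 Ot (translate t).
move=> t' [Tt' Ot']; apply: uniq_t; split=> //.
by apply: cyl_Om.2 Ot' _; exact: agree_sym.
Qed.

Lemma tree_exact_tiling T : tree (~` I) T -> exact_tiling T.
Proof.
move=> tree_T x; have [s [t [Os Tt xst]]] := complementary_trees_sum n0 x tree_Om tree_T.
have Ot : Om (x - t) by apply: cyl_Om.2 Os _; apply: agree_sym; apply/agree_subl.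
exists t; split=> // t' [Tt' Ot']; have [_ split_T _] := tree_T.
exact: complementary_splits_eq split_Om split_T Tt Tt' Ot Ot'.
Qed.

Section ExactTilingIsTree.
Variable T : set QP.
Hypothesis tile_T : exact_tiling T.

Lemma exact_tiling_inj s s' t t' : Om s -> Om s' -> T t -> T t' ->
  agree n0 (s + t) (s' + t') -> t = t' /\ agree n0 s s'.
Proof.
move=> Os Os' Tt Tt' sum_eq; have [t1 [_ uniq_t]] := tile_T (s + t).
have t1t : t1 = t by apply: uniq_t; rewrite addrK.
have t1t' : t1 = t'.
  by apply: uniq_t; split=> //; apply: cyl_Om.2 Os' _; apply: agree_sym; apply/agree_subl.
by move: sum_eq; rewrite -t1t -t1t' => /agreeDr.
Qed.

Section Window.
Variables (N : int) (L : nat) (F G : finType) (a : F -> QP) (r : G -> QP).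
Hypotheses (NM : N <= M) (n0E : n0 = N + L%:Z).
Hypothesis trans_a : transversal n0 Om a.
Hypothesis trans_r : transversal n0 (T `&` zero_below N) r.

Lemma Om_zero_below s : Om s -> zero_below N s.
Proof. by move=> /cyl_Om.1; exact: zero_below_le. Qed.

Lemma exact_tiling_direct_mod : direct_mod (p ^ L) (block N L \o a) (block N L \o r).
Proof.
have [[Oa _ inj_a] [Tr _ inj_r]] := (trans_a, trans_r).
move=> g g' b b' /= block_eq.
have [[Tb Nb] [Tb' Nb']] := (Tr b, Tr b').
have [Ng Ng'] := (Om_zero_below (Oa g), Om_zero_below (Oa g')).
have [rbb' agg'] : r b = r b' /\ agree n0 (a g) (a g').
  apply: exact_tiling_inj => //; rewrite n0E; apply: block_inj; try exact: zero_belowD.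
  by have := blockD L Ng Nb; rewrite block_eq -blockD // !modn_small ?block_lt.
by split; [exact: inj_a|apply: inj_r; rewrite rbb'].
Qed.

Lemma exact_tiling_card : (#|F| * #|G| = p ^ L)%N.
Proof.
have pL : (0 < p ^ L)%N by rewrite expn_gt0 p_gt0.
have [[Oa cover_a _] [Tr cover_r _]] := (trans_a, trans_r).
apply/eqP; rewrite eqn_leq -card_prod; apply/andP; split.
  rewrite -[X in (_ <= X)%N]card_ord.
  exact: leq_card (direct_mod_inj (n_gt0 := pL) exact_tiling_direct_mod).
have below_all : [set: QP] `&` zero_below N `<=` zero_below N by move=> x [].
have [H [h trans_h]] := transversal_exists n0 below_all; have [Nh _ inj_h] := trans_h.
have [_ split_all branch_all] := tree_setT p_gt0; rewrite n0E in trans_h.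
have cardH := tree_card_transversal split_all trans_h branch_all; rewrite order_count_setT in cardH.
rewrite -cardH; last by exists 0.
have decompose z : exists c : F * G, agree n0 (h z) (a c.1 + r c.2).
  have [t [[Tt Ot] _]] := tile_T (h z); have [g sg] := cover_a _ Ot.
  have Nt : zero_below N t.
    by rewrite -[t](subKr (h z)); apply: zero_belowB; [exact: (Nh z).2|exact: Om_zero_below].
  have [b tb] := cover_r t (conj Tt Nt); exists (g, b) => /=.
  rewrite -{1}[h z](subrK t); apply: (agree_trans (y := a g + t)); first exact/agreeDr.
  by rewrite ![a g + _]addrC; apply/agreeDr.
have [f fP] := choice decompose; apply: (@leq_card _ _ f) => z z' ff'; apply: inj_h.
by apply: agree_trans (fP z) _; rewrite ff'; exact: agree_sym.
Qed.

End Window.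

Lemma exact_tiling_splits : splits_within (~` I) T.
Proof.
move=> t t' k Tt Tt' tt' /contrapT Ik; apply: contrapT => dk.
have [[s Os] _ _] := tree_Om.
have kn0 : k < n0.
  rewrite ltNge; apply/negP => n0k; have [|tE _] := exact_tiling_inj Os Os Tt Tt' _.
    by rewrite ![s + _]addrC; apply/agreeDr; exact: agree_le tt'.
  by apply: dk; rewrite tE.
have Mk := tree_orders_ge p_gt1 tree_Om cyl_Om.1 Ik.
have [d ds] : exists d : 'I_p, digit s k <> d.
  by case: (digit s k) => [|j]; [exists (Ordinal p_gt1)|exists (Ordinal p_gt0)].
have [s' [Os' ss' ds']] := branch_Om d Os Ik.
have [N [NM Nt Nt']] := zero_below2 M t t'.
pose L := `|(n0 - N)%R|%N; have n0E : n0 = N + L%:Z by rewrite /L; lia.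
pose i := `|(k - N)%R|%N; have kE : k = N + i%:Z by rewrite /i; lia.
have iL : (i < L)%N by rewrite /i /L; lia.
have [F [a trans_a]] := transversal_exists n0 cyl_Om.1.
have belowT : T `&` zero_below N `<=` zero_below N by move=> x [].
have [G [r trans_r]] := transversal_exists n0 belowT.
have [[_ cover_a _] [_ cover_r _]] := (trans_a, trans_r).
have [[g sg] [g' sg']] := (cover_a s Os, cover_a s' Os').
have [[b tb] [b' tb']] := (cover_r t (conj Tt Nt), cover_r t' (conj Tt' Nt')).
rewrite -ds' kE in ds; rewrite kE in ss' tt' dk.
have [e pe se] := block_diff ss' ds iL; have [e' pe' te] := block_diff tt' dk iL.
rewrite n0E in sg sg' tb tb'.
rewrite (agree_block sg) (agree_block sg') in se; rewrite (agree_block tb) (agree_block tb') in te.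
exact: (direct_mod_orders_disjoint p_prime (exact_tiling_card NM n0E trans_a trans_r)
  (exact_tiling_direct_mod NM n0E trans_a trans_r) se te pe pe').
Qed.

Lemma exact_tiling_tree : tree (~` I) T.
Proof.
have I_level j : (~` I) j -> j < n0.
  by move=> nI; rewrite ltNge; apply/negP => /(tree_cylinder_orders p_gt1 tree_Om cyl_Om).
apply: (tree_of_card (N0 := M) I_level exact_tiling_splits) => N L NM n0E.
have belowT : T `&` zero_below N `<=` zero_below N by move=> x [].
have [F [a trans_a]] := transversal_exists n0 cyl_Om.1.
have [G [r trans_r]] := transversal_exists n0 belowT.
exists G, r; split=> //; have := exact_tiling_card NM n0E trans_a trans_r.
have OmN : Om `&` zero_below N = Om by apply: setIidl => x; exact: Om_zero_below.
have trans_aN : transversal (N + L%:Z) (Om `&` zero_below N) a by rewrite OmN -n0E.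
have OmN0 : Om `&` zero_below N !=set0 by rewrite OmN; case: tree_Om.
rewrite (tree_card_transversal split_Om trans_aN branch_Om OmN0) -{2}(order_countC N L I) expnD.
by move=> /eqP; rewrite eqn_pmul2l ?expn_gt0 ?p_gt0 // => /eqP.
Qed.

End ExactTilingIsTree.

Lemma tilingP (m : {measure set QPm -> \bar R}) (T : set QPm) :
  haar_measure m -> tiling_complement m Om T <-> tree (~` I) T.
Proof.
move=> m_haar; rewrite tiling_complementP //.
by split; [exact: exact_tiling_tree|exact: tree_exact_tiling].
Qed.

End Tiling.

Theorem theorem1p2 (p : nat) (hp : prime p) (R : realType)
  (m : {measure set (QPm (prime_gt0 hp)) -> \bar R})
  (Hm : haar_measure m)
  (Om : set (QPm (prime_gt0 hp)))
  (Hcompact : qp_compact Om) (Hopen : qp_open Om)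
  (Hhom : p_homogeneous Om) (Hpos : (0 < m Om)%E) :
  (spectrum m Om (Lambda0 Om)
   /\ forall Lam : set (QPm (prime_gt0 hp)),
        spectrum m Om Lam <->
        exists f, isometric_bijection f /\ Lam = f @` Lambda0 Om)
  /\
  (tiling_complement m Om (T0 Om)
   /\ forall T : set (QPm (prime_gt0 hp)),
        tiling_complement m Om T <->
        exists f, isometric_bijection f /\ T = f @` T0 Om).
Proof.
have p_gt1 := prime_gt1 hp.
have Om_neq0 : Om !=set0 by apply/set0P; apply: contraTneq Hpos => ->; rewrite measure0 ltxx.
have [M [n0 cyl_Om]] := qp_compact_open_cylinder p_gt1 Hcompact Hopen.
have tree_Om := p_homogeneous_tree p_gt1 Hhom Om_neq0.
set I := adm_orders Om in tree_Om.
have dual_lt := dual_order_lt hp tree_Om cyl_Om.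
have compl_lt j : (~` I) j -> j < n0.
  by move=> nI; rewrite ltNge; apply/negP => /(tree_cylinder_orders p_gt1 tree_Om cyl_Om).
have -> : Lambda0 Om = suppset (dual_orders I).
  by apply: (@digit_sumsetE _ _ I _ (- M)) => // j; lia.
have -> : T0 Om = suppset (~` I) by apply: (@digit_sumsetE _ _ (~` I) _ n0).
split; split=> [|S].
- by apply/(spectrumP hp Hm tree_Om cyl_Om); exact: tree_suppset.
- by rewrite (spectrumP hp Hm tree_Om cyl_Om); exact: treeP dual_lt.
- by apply/(tilingP hp tree_Om cyl_Om _ Hm); exact: tree_suppset.
- by rewrite (tilingP hp tree_Om cyl_Om _ Hm); exact: treeP compl_lt.
Qed.
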